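(* Let $\phi(x)=\frac{ax+b}{cx+d}$ with $a,b,c,d\in\mathbb{Q}_2$, $ad-bc\ne0$, let $\Delta=(d-a)^2+4bc$ and assume $\sqrt{\Delta}\notin\mathbb{Q}_2$. Let $K=\mathbb{Q}_2(\sqrt{\Delta})$, let $\pi$ be a uniformizer of $K$, and suppose that $\lambda=\frac{a+d+\sqrt{\Delta}}{a+d-\sqrt{\Delta}}\in K$ is not a root of unity. Assume $K=\mathbb{Q}_2(\sqrt{-1})$ or $\mathbb{Q}_2(\sqrt{3})$. (1) If $|a+d|_2=|\sqrt{\Delta}|_2$, the system $(\mathbb{P}^1(\mathbb{Q}_2),\phi)$ is decomposed into $2^{(v_\pi(\lambda^2+1)-2)/2}$ minimal subsystems. (2) If $|a+d|_2>|\sqrt{\Delta}|_2$, the system $(\mathbb{P}^1(\mathbb{Q}_2),\phi)$ is decomposed into $2^{v_\pi(\lambda-1)/2}$ minimal subsystems. (3) If $|a+d|_2<|\sqrt{\Delta}|_2$, the system $(\mathbb{P}^1(\mathbb{Q}_2),\phi)$ is decomposed into $2^{v_\pi(\lambda+1)/2}$ minimal subsystems. In all three cases, each minimal subsystem is topologically conjugate to the adding machine on the odometer $\mathbb{Z}_{(p_s)}$ with $(p_s)=(1,2,2^2,\cdots)$.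
   Context: $\mathbb{P}^1(\mathbb{Q}_2)=\mathbb{Q}_2\cup\{\infty\}$ with its usual compact topology. $|\cdot|_2$ and $v_2=-\log_2|\cdot|_2$ are extended to $K$; $v_\pi:=e\,v_2$ where $e$ is the ramification index of $K/\mathbb{Q}_2$ (here $e=2$, so $v_\pi(\pi)=1$). A subsystem is a pair $(E,\phi)$ with $E$ compact and $\phi(E)\subset E$; it is minimal if $E=\overline{\{\phi^n(x):n\ge 0\}}$ for every $x\in E$. ''Decomposed into $M$ minimal subsystems'' means that $\mathbb{P}^1(\mathbb{Q}_2)$ is the disjoint union of $M$ nonempty compact $\phi$-invariant sets, on each of which $\phi$ is minimal. For positive integers $p_s\mid p_{s+1}$ $(s\ge1)$, the odometer $\mathbb{Z}_{(p_s)}$ is the inverse limit of $\mathbb{Z}/p_s\mathbb{Z}$, and the adding machine is $x\mapsto x+1$ on it. *)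

(* Defs.v *)
From HB Require Import structures.
From mathcomp Require Import all_boot all_order all_algebra all_field.
From mathcomp Require Import fraction generic_quotient zify ring lra.
From mathcomp Require Import all_classical all_reals all_analysis.

Set Implicit Arguments.
Unset Strict Implicit.
Unset Printing Implicit Defensive.

Import Order.TTheory GRing.Theory Num.Theory.

Local Open Scope classical_set_scope.
Local Open Scope ring_scope.

(* The inverse limit of the rings Z/p_sZ inside the product of the discrete
   spaces nat, a residue class mod p_s being represented by its least natural
   representative.  Only meaningful when 0 < p s and p s %| p s.+1 for all s;
   the sequence (p_s) is indexed from s = 0. *)
Definition odometer (p : nat -> nat) :
    set (prod_topology (fun _ : nat => nat)) :=
  [set x | forall s, (x s < p s)%N /\ (x s.+1 %% p s)%N = x s].

Definition adding_machine (p : nat -> nat)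
    (x : prod_topology (fun _ : nat => nat)) :
    prod_topology (fun _ : nat => nat) :=
  fun s => ((x s).+1 %% p s)%N.

Definition pow2 (s : nat) : nat := (2 ^ s)%N.

Definition Z2 : Type := set_type (odometer pow2).

HB.instance Definition _ := gen_eqMixin Z2.
HB.instance Definition _ := gen_choiceMixin Z2.

Definition res (x : Z2) (s : nat) : nat := val x s.

Lemma res_lt x s : (res x s < 2 ^ s)%N.
Proof. by case: (set_valP x s). Qed.

Lemma res_mod x s : (res x s.+1 %% 2 ^ s)%N = res x s.
Proof. by case: (set_valP x s). Qed.

Lemma res_modn x s : (res x s %% 2 ^ s)%N = res x s.
Proof. by rewrite modn_small// res_lt. Qed.

Lemma res_mod_le x m n : (m <= n)%N -> (res x n %% 2 ^ m)%N = res x m.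
Proof.
move=> /subnK <-; elim: (n - m)%N => [|k IH]; first exact: res_modn.
rewrite addSn -IH -(res_mod x (k + m)) modn_dvdm//.
by rewrite dvdn_exp2l// leq_addl.
Qed.

Lemma resP x y : (forall s, res x s = res y s) -> x = y.
Proof. by move=> xy; apply/val_inj/funext => s; exact: xy. Qed.

Lemma mkZ2_subproof (f : nat -> nat) :
  (forall s, f s.+1 = f s %[mod 2 ^ s]) ->
  odometer pow2 (fun s => (f s %% 2 ^ s)%N).
Proof.
move=> fP s; split; first by rewrite ltn_mod expn_gt0.
by rewrite modn_dvdm ?fP// dvdn_exp2l.
Qed.

Definition mkZ2 f (fP : forall s, f s.+1 = f s %[mod 2 ^ s]) : Z2 :=
  SigSub (mem_set (mkZ2_subproof fP)).

Lemma res_mkZ2 f fP s : res (@mkZ2 f fP) s = (f s %% 2 ^ s)%N.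
Proof. by []. Qed.

Fact addZ2_subproof (x y : Z2) s :
  (res x s.+1 + res y s.+1 = res x s + res y s %[mod 2 ^ s])%N.
Proof. by rewrite -modnDm !res_mod. Qed.
Definition addZ2 x y := mkZ2 (addZ2_subproof x y).

Fact mulZ2_subproof (x y : Z2) s :
  (res x s.+1 * res y s.+1 = res x s * res y s %[mod 2 ^ s])%N.
Proof. by rewrite -modnMm !res_mod. Qed.
Definition mulZ2 x y := mkZ2 (mulZ2_subproof x y).

Fact oppZ2_subproof (x : Z2) s :
  (2 ^ s.+1 - res x s.+1 = 2 ^ s - res x s %[mod 2 ^ s])%N.
Proof.
apply/eqP; rewrite -(eqn_modDr (res x s.+1)) subnK ?(ltnW (res_lt _ _))//.
by rewrite -modnDmr res_mod subnK ?(ltnW (res_lt _ _))// expnS modnn modnMl.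
Qed.
Definition oppZ2 x := mkZ2 (oppZ2_subproof x).

Definition zeroZ2 : Z2 := @mkZ2 (fun=> 0%N) (fun=> erefl).
Definition oneZ2 : Z2 := @mkZ2 (fun=> 1%N) (fun=> erefl).

Fact addZ2A : associative addZ2.
Proof. by move=> x y z; apply: resP => s; rewrite !res_mkZ2 modnDmr modnDml addnA. Qed.
Fact addZ2C : commutative addZ2.
Proof. by move=> x y; apply: resP => s; rewrite !res_mkZ2 addnC. Qed.
Fact add0Z2 : left_id zeroZ2 addZ2.
Proof. by move=> x; apply: resP => s; rewrite !res_mkZ2 mod0n add0n res_modn. Qed.
Fact addNZ2 : left_inverse zeroZ2 oppZ2 addZ2.
Proof.
move=> x; apply: resP => s; rewrite !res_mkZ2 modnDml subnK ?modnn ?mod0n//.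
exact/ltnW/res_lt.
Qed.
HB.instance Definition _ := GRing.isZmodule.Build Z2 addZ2A addZ2C add0Z2 addNZ2.

Fact mulZ2A : associative mulZ2.
Proof. by move=> x y z; apply: resP => s; rewrite !res_mkZ2 modnMmr modnMml mulnA. Qed.
Fact mulZ2C : commutative mulZ2.
Proof. by move=> x y; apply: resP => s; rewrite !res_mkZ2 mulnC. Qed.
Fact mul1Z2 : left_id oneZ2 mulZ2.
Proof. by move=> x; apply: resP => s; rewrite !res_mkZ2 modnMml mul1n res_modn. Qed.
Fact mulZ2Dl : left_distributive mulZ2 addZ2.
Proof.
by move=> x y z; apply: resP => s; rewrite !res_mkZ2 modnMml modnDm mulnDl.
Qed.
Fact oneZ2_neq0 : oneZ2 != 0.
Proof. by apply/eqP => /(congr1 (res^~ 1%N)). Qed.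
HB.instance Definition _ :=
  GRing.Zmodule_isComNzRing.Build Z2 mulZ2A mulZ2C mul1Z2 mulZ2Dl oneZ2_neq0.

Lemma res0 s : res 0 s = 0%N. Proof. exact: mod0n. Qed.
Lemma resD x y s : res (x + y) s = ((res x s + res y s) %% 2 ^ s)%N.
Proof. by []. Qed.
Lemma resM x y s : res (x * y) s = ((res x s * res y s) %% 2 ^ s)%N.
Proof. by []. Qed.

Definition unitZ2 : {pred Z2} := fun x => `[< exists y, y * x = 1 >].
Definition invZ2 (x : Z2) : Z2 := xget x [set y | y * x = 1].

Fact mulVZ2 : {in unitZ2, left_inverse 1 invZ2 *%R}.
Proof. by move=> x /asboolP [y yx]; rewrite /invZ2; case: xgetP => [z _//|/(_ y)]. Qed.
Fact unitZ2Pl x y : y * x = 1 -> unitZ2 x.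
Proof. by move=> yx; apply/asboolP; exists y. Qed.
Fact invZ2_out : {in [predC unitZ2], invZ2 =1 id}.
Proof.
move=> x /asboolPn nx; rewrite /invZ2; case: xgetP => [z _ /= zx|//].
by case: nx; exists z.
Qed.
HB.instance Definition _ :=
  GRing.ComNzRing_hasMulInverse.Build Z2 mulVZ2 unitZ2Pl invZ2_out.

(* has_val x n : the 2-adic valuation of x is n *)
Definition has_val (x : Z2) (n : nat) : Prop := res x n = 0%N /\ res x n.+1 <> 0%N.

Lemma res_eq0_le x m n : (m <= n)%N -> res x n = 0%N -> res x m = 0%N.
Proof. by move=> mn xn; rewrite -(res_mod_le x mn) xn mod0n. Qed.

Lemma has_val_ex x : x != 0 -> exists n, has_val x n.
Proof.
move=> /eqP x0; have [s xs] : exists s, res x s != 0%N.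
  apply: contrapT => nx; apply: x0; apply: resP => s; rewrite res0.
  by apply: contrapT => /eqP xs; apply: nx; exists s.
have : exists s, res x s != 0%N by exists s.
move=> /ex_minnP [[|m]].
  by have := res_lt x 0; rewrite expn0 ltnS leqn0 => ->.
move=> xm mmin; exists m; split; last exact/eqP.
by apply: contrapT => /eqP /mmin; rewrite ltnn.
Qed.

Lemma has_val_le x n m : has_val x n -> res x m = 0%N -> (m <= n)%N.
Proof.
move=> [_ xn] xm; rewrite leqNgt; apply/negP => nm.
exact/xn/(res_eq0_le nm).
Qed.

Lemma has_val_uniq x n m : has_val x n -> has_val x m -> n = m.
Proof.
move=> xn xm; apply/eqP; rewrite eqn_leq.
by rewrite (has_val_le xm xn.1) (has_val_le xn xm.1).
Qed.

Lemma has_val_neq0 x n : has_val x n -> x != 0.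
Proof. by move=> [_ xn]; apply/eqP => x0; apply: xn; rewrite x0 res0. Qed.

Lemma has_val_logn x n s : (n < s)%N -> has_val x n ->
  (0 < res x s)%N /\ logn 2 (res x s) = n.
Proof.
move=> ns [xn xn1]; have xs : (0 < res x s)%N.
  by rewrite lt0n; apply/eqP => xs; apply: xn1; apply: res_eq0_le xs.
split=> //; apply/eqP; rewrite eqn_leq -pfactor_dvdn// leqNgt -pfactor_dvdn//.
rewrite /dvdn !res_mod_le// ?(ltnW ns)// xn eqxx andbT.
exact/eqP.
Qed.

Lemma has_valM x y n m : has_val x n -> has_val y m -> has_val (x * y) (n + m).
Proof.
move=> vx vy; set s := (n + m).+1.
have [x0 lx] := has_val_logn (leq_addr m n : n < s)%N vx.
have [y0 ly] := has_val_logn (leq_addl n m : m < s)%N vy.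
have xy0 : (0 < res x s * res y s)%N by rewrite muln_gt0 x0.
split.
  apply/eqP; rewrite -(res_mod_le (x * y) (leqnSn (n + m))) resM.
  rewrite modn_dvdm ?dvdn_exp2l//.
  by rewrite -/(dvdn _ _) pfactor_dvdn// lognM// lx ly.
apply/eqP; rewrite -/s resM -/(dvdn _ _) pfactor_dvdn// lognM// lx ly.
by rewrite -ltnNge.
Qed.

Fact mulZ2_eq0 : GRing.integral_domain_axiom Z2.
Proof.
move=> x y xy0; apply: contraT; rewrite negb_or => /andP[].
move=> /has_val_ex[n vx] /has_val_ex[m vy].
by have := has_val_neq0 (has_valM vx vy); rewrite xy0 eqxx.
Qed.
HB.instance Definition _ := GRing.ComUnitRing_isIntegral.Build Z2 mulZ2_eq0.

(* junk value 0 at x = 0 *)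
Definition valZ2 (x : Z2) : nat := xget 0%N [set n | has_val x n].

Lemma valZ2P x : x != 0 -> has_val x (valZ2 x).
Proof. by move=> /has_val_ex[n xn]; rewrite /valZ2; case: xgetP => [m _//|/(_ n)]. Qed.

Lemma valZ2E x n : has_val x n -> valZ2 x = n.
Proof. by move=> xn; apply/has_val_uniq/xn/valZ2P/has_val_neq0/xn. Qed.

Lemma valZ2M x y : x != 0 -> y != 0 -> valZ2 (x * y) = (valZ2 x + valZ2 y)%N.
Proof. by move=> x0 y0; apply: valZ2E; apply: has_valM; apply: valZ2P. Qed.

Lemma valZ2D x y : x != 0 -> y != 0 -> x + y != 0 ->
  (minn (valZ2 x) (valZ2 y) <= valZ2 (x + y)%R)%N.
Proof.
move=> /valZ2P[vx _] /valZ2P[vy _] /valZ2P vxy; apply: (has_val_le vxy).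
by rewrite resD (res_eq0_le (geq_minl _ _) vx) (res_eq0_le (geq_minr _ _) vy) mod0n.
Qed.

Lemma valZ2N x : valZ2 (- x) = valZ2 x.
Proof.
have vN z n : has_val z n -> has_val (- z) n.
  have N0 (t : Z2) s : res t s = 0%N -> res (- t) s = 0%N.
    by move=> ts; have := resD (- t) t s; rewrite addNr res0 ts addn0 res_modn.
  by move=> [zn zn1]; split; [exact: N0 | move=> /N0; rewrite opprK].
have [->|/valZ2P /vN /valZ2E//] := eqVneq x 0; by rewrite oppr0.
Qed.

(* Q2 is {fraction Z2}.  It is wrapped in a record with locked operations and
   classical equality only to keep tactics from unfolding the quotient. *)
Record Q2 : Type := MkQ2 { fracQ2 : {fraction Z2} }.

HB.lock Definition zeroQ2 : Q2 := MkQ2 0.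
HB.lock Definition oneQ2 : Q2 := MkQ2 1.
HB.lock Definition oppQ2 (x : Q2) : Q2 := MkQ2 (- fracQ2 x).
HB.lock Definition addQ2 (x y : Q2) : Q2 := MkQ2 (fracQ2 x + fracQ2 y).
HB.lock Definition mulQ2 (x y : Q2) : Q2 := MkQ2 (fracQ2 x * fracQ2 y).
HB.lock Definition invQ2 (x : Q2) : Q2 := MkQ2 (fracQ2 x)^-1.
HB.lock Definition toQ2 (x : Z2) : Q2 := MkQ2 (FracField.tofrac x).

Lemma fracQ2_inj : injective fracQ2.
Proof. by case=> x [y] /= ->. Qed.

Definition fracQ2E := (zeroQ2.unlock, oneQ2.unlock, oppQ2.unlock, addQ2.unlock,
  mulQ2.unlock, invQ2.unlock, toQ2.unlock).

HB.instance Definition _ := gen_eqMixin Q2.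
HB.instance Definition _ := gen_choiceMixin Q2.

Fact addQ2A : associative addQ2.
Proof. by move=> x y z; apply: fracQ2_inj; rewrite !fracQ2E /= addrA. Qed.
Fact addQ2C : commutative addQ2.
Proof. by move=> x y; apply: fracQ2_inj; rewrite !fracQ2E /= addrC. Qed.
Fact add0Q2 : left_id zeroQ2 addQ2.
Proof. by move=> x; apply: fracQ2_inj; rewrite !fracQ2E /= add0r. Qed.
Fact addNQ2 : left_inverse zeroQ2 oppQ2 addQ2.
Proof. by move=> x; apply: fracQ2_inj; rewrite !fracQ2E /= addNr. Qed.
HB.instance Definition _ := GRing.isZmodule.Build Q2 addQ2A addQ2C add0Q2 addNQ2.

Fact mulQ2A : associative mulQ2.
Proof. by move=> x y z; apply: fracQ2_inj; rewrite !fracQ2E /= mulrA. Qed.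
Fact mulQ2C : commutative mulQ2.
Proof. by move=> x y; apply: fracQ2_inj; rewrite !fracQ2E /= mulrC. Qed.
Fact mul1Q2 : left_id oneQ2 mulQ2.
Proof. by move=> x; apply: fracQ2_inj; rewrite !fracQ2E /= mul1r. Qed.
Fact mulQ2Dl : left_distributive mulQ2 addQ2.
Proof. by move=> x y z; apply: fracQ2_inj; rewrite !fracQ2E /= mulrDl. Qed.
Fact oneQ2_neq0 : oneQ2 != 0.
Proof.
apply/eqP; change (oneQ2 <> zeroQ2) => /(congr1 fracQ2).
by rewrite !fracQ2E /= => /eqP; rewrite oner_eq0.
Qed.
HB.instance Definition _ :=
  GRing.Zmodule_isComNzRing.Build Q2 mulQ2A mulQ2C mul1Q2 mulQ2Dl oneQ2_neq0.

Fact mulVQ2 (x : Q2) : x != 0 -> invQ2 x * x = 1.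
Proof.
move=> /eqP x0; change (mulQ2 (invQ2 x) x = oneQ2).
apply: fracQ2_inj; rewrite !fracQ2E /= mulVf//; apply/eqP => fx0; apply: x0.
by change (x = zeroQ2); apply: fracQ2_inj; rewrite !fracQ2E.
Qed.
Fact invQ20 : invQ2 0 = 0.
Proof.
by change (invQ2 zeroQ2 = zeroQ2); apply: fracQ2_inj; rewrite !fracQ2E /= invr0.
Qed.
HB.instance Definition _ := GRing.ComNzRing_isField.Build Q2 mulVQ2 invQ20.

Definition numQ2 (x : Q2) : Z2 := (frac (repr (fracQ2 x))).1.
Definition denQ2 (x : Q2) : Z2 := (frac (repr (fracQ2 x))).2.

(* junk value 0 at x = 0 *)
Definition val2 (x : Q2) : int :=
  (valZ2 (numQ2 x))%:Z - (valZ2 (denQ2 x))%:Z.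

Definition abs2 (x : Q2) : rat := if x == 0 then 0 else 2 ^ (- val2 x).

Lemma toQ2M : {morph toQ2 : x y / x * y}.
Proof.
move=> x y; change (toQ2 (x * y) = mulQ2 (toQ2 x) (toQ2 y)).
by apply: fracQ2_inj; rewrite !fracQ2E /= tofracM.
Qed.
Lemma toQ2D : {morph toQ2 : x y / x + y}.
Proof.
move=> x y; change (toQ2 (x + y) = addQ2 (toQ2 x) (toQ2 y)).
by apply: fracQ2_inj; rewrite !fracQ2E /= tofracD.
Qed.
Lemma toQ2_inj : injective toQ2.
Proof.
move=> x y /(congr1 fracQ2); rewrite !fracQ2E /= => /eqP.
by rewrite tofrac_eq => /eqP.
Qed.
Lemma toQ20 : toQ2 0 = 0.
Proof. by apply: (addrI (toQ2 0)); rewrite -toQ2D !addr0. Qed.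
Lemma toQ2N : {morph toQ2 : x / - x}.
Proof.
by move=> x; apply: (addrI (toQ2 x)); rewrite -toQ2D !subrr toQ20.
Qed.
Lemma toQ21 : toQ2 1 = 1.
Proof.
by change (toQ2 1 = oneQ2); apply: fracQ2_inj; rewrite !fracQ2E /= tofrac1.
Qed.
Lemma toQ2_eq0 x : (toQ2 x == 0) = (x == 0).
Proof. by rewrite -toQ20 (inj_eq toQ2_inj). Qed.
Lemma toQ2_div_neq0 n d : toQ2 n / toQ2 d != 0 -> n != 0.
Proof. by apply: contra => /eqP ->; rewrite toQ20 mul0r. Qed.

HB.instance Definition _ := GRing.isZmodMorphism.Build Z2 Q2 toQ2
  (fun x y => etrans (toQ2D x (- y)) (congr1 (+%R (toQ2 x)) (toQ2N y))).
HB.instance Definition _ :=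
  GRing.isMonoidMorphism.Build Z2 Q2 toQ2 (conj toQ21 toQ2M).

Lemma denQ2_neq0 (x : Q2) : denQ2 x != 0.
Proof. exact: denom_ratioP. Qed.

Lemma fracE (x : Q2) : x = toQ2 (numQ2 x) / toQ2 (denQ2 x).
Proof.
have d0 : toQ2 (denQ2 x) != 0 by rewrite toQ2_eq0 denQ2_neq0.
apply: (mulIf d0); rewrite divfK//.
change (mulQ2 x (toQ2 (denQ2 x)) = toQ2 (numQ2 x)).
apply: fracQ2_inj; rewrite !fracQ2E /= -{1}[fracQ2 x]reprK; unlock FracField.tofrac.
rewrite -[LHS]FracField.pi_mul; apply/eqmodP.
rewrite /= FracField.equivfE /numQ2 /denQ2 /FracField.mulf !numden_Ratio ?oner_eq0//.
- by rewrite !mulr1 mulrC.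
all: by rewrite mulr1 denom_ratioP.
Qed.

Lemma val2_frac (n d : Z2) : n != 0 -> d != 0 ->
  val2 (toQ2 n / toQ2 d) = (valZ2 n)%:Z - (valZ2 d)%:Z.
Proof.
move=> n0 d0; set x := toQ2 n / toQ2 d; rewrite /val2.
have x0 : x != 0 by rewrite mulf_neq0 ?invr_eq0// toQ2_eq0.
set a := numQ2 x; set b := denQ2 x.
have b0 : b != 0 by exact: denQ2_neq0.
have xE : x = toQ2 a / toQ2 b by exact: fracE.
have a0 : a != 0 by apply: (@toQ2_div_neq0 _ b); rewrite -xE.
have : toQ2 (n * b) = toQ2 (a * d).
  by rewrite !toQ2M; apply/eqP; rewrite -eqr_div ?toQ2_eq0// -xE.
move=> /toQ2_inj /(congr1 valZ2); rewrite !valZ2M// => h.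
by apply/eqP; rewrite subr_eq addrAC eq_sym subr_eq -!PoszD h.
Qed.

Lemma frac_ex (x : Q2) : exists n d, d != 0 /\ x = toQ2 n / toQ2 d.
Proof.
by exists (numQ2 x), (denQ2 x); split; [exact: denQ2_neq0 | exact: fracE].
Qed.

Lemma val2M x y : x != 0 -> y != 0 -> val2 (x * y) = val2 x + val2 y.
Proof.
have [n [d [d0 ->]]] := frac_ex x; have [m [e [e0 ->]]] := frac_ex y.
move=> /toQ2_div_neq0 n0 /toQ2_div_neq0 m0.
rewrite mulrACA -invfM -!toQ2M.
rewrite !val2_frac ?mulf_neq0// !valZ2M// !PoszD.
by rewrite opprD addrACA.
Qed.

Lemma val2D x y : x != 0 -> y != 0 -> x + y != 0 ->
  (Num.min (val2 x) (val2 y) <= val2 (x + y))%R.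
Proof.
have [n [d [d0 ->]]] := frac_ex x; have [m [e [e0 ->]]] := frac_ex y.
have td : toQ2 d != 0 by rewrite toQ2_eq0.
have te : toQ2 e != 0 by rewrite toQ2_eq0.
have -> : toQ2 n / toQ2 d + toQ2 m / toQ2 e = toQ2 (n * e + m * d) / toQ2 (d * e).
  by rewrite addf_div// toQ2D !toQ2M.
move=> /toQ2_div_neq0 n0 /toQ2_div_neq0 m0 /toQ2_div_neq0 s0.
rewrite !val2_frac ?mulf_neq0// (valZ2M d0 e0).
have := valZ2D (mulf_neq0 n0 e0) (mulf_neq0 m0 d0) s0.
rewrite !valZ2M//; set s := valZ2 (_ + _).
rewrite geq_min ge_min => /orP[] h; apply/orP; [left|right]; lia.
Qed.

Lemma val2N x : val2 (- x) = val2 x.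
Proof.
have [->|] := eqVneq x 0; first by rewrite oppr0.
have [n [d [d0 ->]]] := frac_ex x.
move=> /toQ2_div_neq0 n0.
by rewrite -mulNr -toQ2N !val2_frac ?oppr_eq0// valZ2N.
Qed.

Lemma abs2_ge0 x : 0 <= abs2 x.
Proof. by rewrite /abs2; case: ifP => // _; rewrite exprz_ge0. Qed.

Lemma abs2_eq0 x : (abs2 x == 0) = (x == 0).
Proof. by rewrite /abs2; case: ifP => // _; rewrite expfz_eq0 andbF. Qed.

Lemma abs2M x y : abs2 (x * y) = abs2 x * abs2 y.
Proof.
rewrite /abs2 mulf_eq0; case: eqVneq => [|x0]; first by rewrite mul0r.
case: eqVneq => [|y0]; first by rewrite mulr0.
by rewrite val2M// opprD expfzDr.
Qed.

Lemma abs2N x : abs2 (- x) = abs2 x.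
Proof. by rewrite /abs2 oppr_eq0 val2N. Qed.

Lemma abs2D x y : abs2 (x + y) <= Num.max (abs2 x) (abs2 y).
Proof.
have [->|x0] := eqVneq x 0; first by rewrite add0r le_max lexx orbT.
have [->|y0] := eqVneq y 0; first by rewrite addr0 le_max lexx.
have [xy0|xy0] := eqVneq (x + y) 0.
  by rewrite xy0 /(abs2 0) eqxx le_max abs2_ge0.
rewrite /abs2 (negbTE x0) (negbTE y0) (negbTE xy0) le_max !ler_eXz2l ?ltr1n//.
by rewrite !lerN2 -ge_min val2D.
Qed.

Definition dist2 (x y : Q2) : rat := abs2 (x - y).

Fact dist2xx x : dist2 x x = 0.
Proof. by rewrite /dist2 subrr /abs2 eqxx. Qed.
Fact dist2_eq0 x y : dist2 x y = 0 -> x = y.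
Proof. by move=> /eqP; rewrite abs2_eq0 subr_eq0 => /eqP. Qed.
Fact dist2C x y : dist2 x y = dist2 y x.
Proof. by rewrite /dist2 -abs2N opprB. Qed.
Fact dist2_triangle y x z : dist2 x z <= dist2 x y + dist2 y z.
Proof.
rewrite /dist2 -(subrKA y); apply: le_trans (abs2D _ _) _.
by rewrite ge_max lerDl lerDr !abs2_ge0.
Qed.
HB.instance Definition _ :=
  isMetric.Build rat Q2 dist2xx dist2_eq0 dist2C dist2_triangle.

(* Q2 is locally compact Hausdorff, so the usual topology of Q2 + {oo} is that
   of the one-point compactification; [None] is the point at infinity. *)
Definition P1Q2 := one_point_compactification Q2.
HB.instance Definition _ := Topological.on P1Q2.

Definition homographic (a b c d : Q2) (x : P1Q2) : P1Q2 :=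
  match x with
  | None => if c == 0 then None else Some (a / c)
  | Some z => if c * z + d == 0 then None else Some ((a * z + b) / (c * z + d))
  end.

Definition subsystem (X : topologicalType) (f : X -> X) (E : set X) : Prop :=
  compact E /\ f @` E `<=` E.

Definition minimal_subsystem (X : topologicalType) (f : X -> X) (E : set X) :
    Prop :=
  subsystem f E /\
  forall x, E x -> E = closure [set iter n f x | n in [set: nat]].

Definition decomposed_into (X : topologicalType) (f : X -> X) (M : nat) : Prop :=
  exists E : 'I_M -> set X,
    [/\ forall i, E i !=set0,
        forall i, minimal_subsystem f (E i),
        trivIset [set: 'I_M] E &
        \bigcup_(i in [set: 'I_M]) E i = [set: X]].

Definition topologically_conjugate (X Y : topologicalType)
    (E : set X) (f : X -> X) (F : set Y) (g : Y -> Y) : Prop :=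
  exists (h : X -> Y) (k : Y -> X),
    [/\ h @` E `<=` F, k @` F `<=` E,
        {in E, cancel h k}, {in F, cancel k h} &
        [/\ {within E, continuous h}, {within F, continuous k} &
            {in E, forall x, h (f x) = g (h x)}]].

Section Extension.
Context {R : realType} {K : fieldExtType Q2}.

(* There is exactly one such absolute value on K. *)
Definition extends_abs2 (absK : K -> R) : Prop :=
  [/\ forall x, 0 <= absK x /\ (absK x = 0 <-> x = 0),
      forall x y, absK (x * y) = absK x * absK y,
      forall x y, absK (x + y) <= Num.max (absK x) (absK y) &
      forall x : Q2, absK x%:A = ratr (abs2 x)].

(* pi generates the maximal ideal of the valuation ring of K *)
Definition uniformizer (absK : K -> R) (pi : K) : Prop :=
  absK pi < 1 /\ forall x, absK x < 1 -> absK x <= absK pi.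

(* 2 and pi^e generate the same ideal of the valuation ring of K *)
Definition ramification_index (absK : K -> R) (pi : K) (e : nat) : Prop :=
  absK 2 = absK pi ^+ e.

(* v_pi = e v_2 with v_2 = - log_2 |.|; junk value 0 at x = 0 *)
Definition val_pi (absK : K -> R) (e : nat) (x : K) : R :=
  e%:R * - (ln (absK x) / ln 2).

Definition is_root_of_unity (x : K) : Prop := exists2 n, (0 < n)%N & x ^+ n = 1.

(* K = Q2(x) *)
Definition generated_by (x : K) : Prop := <<1; x>>%VS = fullv.

End Extension.

(* Main.v *)
(* The fixed points z1, z2 of phi are conjugate over Q2, so z |-> (z - z1)/(z - z2)
   identifies P1(Q2) with the group of norm-one elements of K (Hilbert 90) and turns
   phi into the rotation by lambda.  Let W_m be the subgroup of norm-one u with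
   |u - 1| <= 2^-m.  For both fields the quotient by W_2 is cyclic of order 4, generated
   by (1 + s)/(1 - s) where s^2 = -1 or 3, each W_m/W_{m+1} with m >= 2 has order 2,
   and squaring maps W_m \ W_{m+1} into W_{m+1} \ W_{m+2}.  If lambda has order 2^r
   modulo W_2, where r = 0, 1, 2 according to whether |a + d| is greater than, less
   than or equal to |sqrt Delta|, and lambda^(2^r) lies in W_q \ W_{q+1}, then lambda
   has order 2^(r+n) modulo W_{q+n}.  Hence its orbit closures are odometers, and
   there are 2^(q-r) of them. *)

Require Import Defs.
From mathcomp Require Import all_boot all_order all_algebra all_field.
From mathcomp Require Import cyclic zify ring lra.
From mathcomp Require Import all_classical all_reals all_analysis.

Set Implicit Arguments.
Unset Strict Implicit.
Unset Printing Implicit Defensive.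

Import Order.TTheory GRing.Theory Num.Theory.

Local Open Scope classical_set_scope.
Local Open Scope ring_scope.

(** * Compact systems with a separating tower of cyclic quotients *)

(** The norm-one group is handled without Galois theory: its elements other than 1 are written (t +
    s)/(t - s) with t in Q2, and every estimate reduces to |t - s|, which is |t| if |t| > 1, 1 if
    |t| < 1, and |1 - s| = 2^(-1/2) if |t| = 1. This is the origin of the three cases: sqrt Delta =
    p s with p in Q2 and |s| = 1, so lambda has parameter (a + d)/p, whose absolute value compares
    |a + d| with |sqrt Delta|. It also explains why integer levels W_m suffice although K is
    ramified: for u near 1 the parameter has |t| > 1, so |u - 1| = 1/(2|t|) is an integer power of
    2. The tower starts at W_2 because there w + 1 = 2 + (w - 1) has absolute value exactly 1/2, so
    squaring halves |w - 1|. The two fields are treated together because 1 + s^2 is 0 or 4. The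
    dynamics only sees a decreasing sequence of open equivalence relations on a compact space, which
    keeps topology and arithmetic apart. *)

Lemma nbhs_coord (z : prod_topology (fun _ : nat => nat)) n :
  nbhs z [set y | y n = z n].
Proof.
apply: (@proj_continuous nat (fun=> nat) n z [set m | m = z n]).
exact: discrete_set1.
Qed.

Lemma cvg_coord (F : set_system (prod_topology (fun _ : nat => nat)))
    {FF : Filter F} (z : prod_topology (fun _ : nat => nat)) :
  (forall n, F [set y | y n = z n]) -> F --> z.
Proof.
move=> Fz; apply/cvg_sup => i U [_ [[V oV <-] /= Vz VU]].
by apply: filterS (Fz i) => y /= yz; apply: VU; rewrite /preimage/= yz.
Qed.

Section ProfiniteOrbits.
Variables (X : topologicalType) (f : X -> X) (E : nat -> X -> X -> Prop) (r : nat).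
Hypothesis X_compact : compact [set: X].
Hypothesis Erefl : forall s x, E s x x.
Hypothesis Esym : forall s x y, E s x y -> E s y x.
Hypothesis Etrans : forall s x y z, E s x y -> E s y z -> E s x z.
Hypothesis Ele : forall s t x y, (s <= t)%N -> E t x y -> E s x y.
Hypothesis E_nbhs : forall s x, nbhs x (E s x).
Hypothesis Esep : forall x y, (forall s, E s x y) -> x = y.
Hypothesis Ef : forall s x y, E s x y -> E s (f x) (f y).
Hypothesis Eper : forall s x i j,
  E s (iter i f x) (iter j f x) <-> i = j %[mod 2 ^ (s + r)].
Hypothesis Ecov : forall x y n, E 0 y (iter n f x) ->
  forall s, exists j, E s y (iter j f x).

(** The orbit closure of [x], phrased through the classes of [E s]. By [Ecov] it is the union of the
    level 0 classes that the orbit meets, so hulls can be told apart at level 0. *)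
Definition hull x : set X := [set y | forall s, exists j, E s y (iter j f x)].

Let Eiter s x y n : E s x y -> E s (iter n f x) (iter n f y).
Proof. by move=> xy; elim: n => [//|n IH]; rewrite !iterS; exact: Ef. Qed.

(** Compactness turns separation into a neighbourhood basis: points of [E s x] outside [U], one for
    each [s], would cluster at a point lying in every class of [x], hence at [x] itself. *)
Lemma nbhs_class x U : nbhs x U -> exists s, E s x `<=` U.
Proof.
move=> xU; apply: contrapT => nU.
have /choice [y yP] : forall s, exists y, E s x y /\ ~ U y.
  move=> s; apply: contrapT => ny; apply: nU; exists s => y xy.
  by apply: contrapT => Uy; apply: ny; exists y.
have [z [_ zP]] : [set: X] `&` cluster (y @ \oo) !=set0.
  by apply: X_compact; exact: filterT.
have xz : x = z.
  apply: Esep => s.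
  have ys : (y @ \oo) [set t | E s x t].
    exists s => // n /= sn; apply: (Ele sn); exact: (yP n).1.
  have [t [/= xt zt]] := zP _ _ ys (E_nbhs s z).
  exact: Etrans xt (Esym zt).
have yN : (y @ \oo) (~` U) by exists 0%N => // n /= _; exact: (yP n).2.
by rewrite xz in xU; have [t [/= nt ut]] := zP _ _ yN xU.
Qed.

Lemma closure_orbit x : closure [set iter n f x | n in [set: nat]] = hull x.
Proof.
apply/seteqP; split => y.
  move=> ycl s; have [_ [[n _ <-] yn]] := ycl _ (E_nbhs s y).
  by exists n.
move=> yx B /nbhs_class[s sB]; have [j yj] := yx s.
by exists (iter j f x); split; [exists j | exact: sB].
Qed.

Lemma hull_refl x : hull x x.
Proof. by move=> s; exists 0%N. Qed.

Lemma hull_of_class x y n : E 0 y (iter n f x) -> hull x y.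
Proof. exact: Ecov. Qed.

Lemma hull_sub x y : hull x y -> hull y `<=` hull x.
Proof.
move=> yx z zy s; have [j zj] := zy s; have [i yi] := yx s.
by exists (j + i)%N; rewrite iterD; apply: Etrans zj _; exact: Eiter.
Qed.

Lemma hull_sym x y : hull x y -> hull y x.
Proof.
(* After [j] steps from [x] to the class of [y], another [j * (2 ^ r - 1)] steps complete a multiple
   of the level 0 period [2 ^ r] and return to the class of [x]. *)
move=> /(_ 0%N)[j yj]; apply: (@hull_of_class _ _ (j * (2 ^ r).-1)%N).
apply: Esym; apply: Etrans (Eiter _ yj) _; rewrite -iterD.
apply/(Eper 0 x _ 0); rewrite add0n -mulnSr prednK ?expn_gt0//.
by rewrite modnMl mod0n.
Qed.

Lemma hull_eq x y : hull x y -> hull y = hull x.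
Proof.
by move=> xy; apply/seteqP; split; apply: hull_sub => //; exact: hull_sym.
Qed.

Lemma minimal_hull x : minimal_subsystem f (hull x).
Proof.
split; last by move=> y xy; rewrite closure_orbit (hull_eq xy).
split.
  apply: (subclosed_compact _ X_compact) => //.
  by rewrite -closure_orbit; exact: closed_closure.
move=> _ [y yx <-] s; have [j yj] := yx s.
by exists j.+1; rewrite iterS; exact: Ef.
Qed.

Lemma minimal_subsystem_hull (A : set X) x :
  minimal_subsystem f A -> A x -> A = hull x.
Proof. by move=> [_ Amin] Ax; rewrite -closure_orbit -Amin. Qed.

Lemma decomposed_into_hulls (M : nat) (x : 'I_M -> X) :
  (forall y, exists k n, E 0 y (iter n f (x k))) ->
  (forall k l n m, E 0 (iter n f (x k)) (iter m f (x l)) -> k = l) ->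
  decomposed_into f M.
Proof.
move=> xcov xinj; exists (fun k => hull (x k)); split.
- by move=> k; exists (x k); exact: hull_refl.
- by move=> k; exact: minimal_hull.
- move=> k l _ _ [y [/(_ 0%N)[n yn] /(_ 0%N)[m ym]]].
  exact: xinj (Etrans (Esym yn) ym).
- apply/seteqP; split => // y _; have [k [n ykn]] := xcov y.
  by exists k => //; exact: hull_of_class ykn.
Qed.

(** * Conjugacy of an orbit closure with the 2-adic odometer *)

Section Conjugacy.
Variable x0 : X.

Definition hull_time s y : nat := xget 0%N [set j | E s y (iter j f x0)].

(** By [Eper] the time at level [s] is determined modulo [2 ^ (s + r)]. Keeping it only modulo
    [2 ^ s] gives the standard odometer; the price is that the class at level [s] must be read off
    coordinate [s + r]. *)
Definition hull_code (y : X) : prod_topology (fun _ : nat => nat) :=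
  fun s => (hull_time s y %% 2 ^ s)%N.

Definition hull_decode (z : prod_topology (fun _ : nat => nat)) : X :=
  xget x0 [set y | hull x0 y /\ hull_code y = z].

Let timeP s y : hull x0 y -> E s y (iter (hull_time s y) f x0).
Proof.
by move=> /(_ s)[j yj]; rewrite /hull_time; case: xgetP => [i _ //|/(_ j)].
Qed.

Let pow2S s : (2 ^ s %| 2 ^ (s + r))%N. Proof. by rewrite dvdn_exp2l// leq_addr. Qed.

Let time_mod s y i : E s y (iter i f x0) -> hull x0 y ->
  hull_time s y = i %[mod 2 ^ s].
Proof.
move=> yi /(timeP s) yt; have /Eper := Etrans (Esym yt) yi.
by move=> h; rewrite -(modn_dvdm _ (pow2S s)) h modn_dvdm.
Qed.

Let codeP y : hull x0 y -> odometer pow2 (hull_code y).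
Proof.
move=> xy s; rewrite /hull_code /pow2; split; first by rewrite ltn_mod expn_gt0.
rewrite modn_dvdm ?dvdn_exp2l//; apply/esym/time_mod => //.
by apply: Ele (timeP _ xy).
Qed.

Let code_class s y y' : hull x0 y -> hull x0 y' ->
  hull_code y (s + r)%N = hull_code y' (s + r)%N -> E s y y'.
Proof.
move=> xy xy' yy'.
have := (Ele (leq_addr r s) (timeP (s + r) xy)).
have := (Ele (leq_addr r s) (timeP (s + r) xy')).
move=> /Esym h' h; apply: Etrans h (Etrans _ h').
exact/Eper.
Qed.

Let code_inj y y' : hull x0 y -> hull x0 y' -> hull_code y = hull_code y' -> y = y'.
Proof. by move=> xy xy' yy'; apply: Esep => s; apply: code_class => //; rewrite yy'. Qed.

Let class_code s y y' : hull x0 y -> hull x0 y' -> E s y y' ->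
  hull_code y s = hull_code y' s.
Proof.
by move=> xy xy' yy'; apply: time_mod => //; apply: Etrans yy' (timeP _ xy').
Qed.

(** The times [z s] are coherent, so the points [iter (z s) f x0] eventually stay in one class at
    each level; any cluster point has code [z]. *)
Let code_surj z : odometer pow2 z -> exists2 y, hull x0 y & hull_code y = z.
Proof.
move=> zP.
have zmod s t : (s <= t)%N -> (z t %% 2 ^ s)%N = z s.
  move=> /subnK <-; elim: (t - s)%N => [|k IH].
    by rewrite add0n modn_small//; exact: (zP s).1.
  rewrite addSn -[RHS]IH -(zP (k + s)%N).2 modn_dvdm// dvdn_exp2l//.
  exact: leq_addl.
have [y [_ yP]] :
    [set: X] `&` cluster ((fun s => iter (z s) f x0) @ \oo) !=set0.
  by apply: X_compact; exact: filterT.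
have yz s t : (s + r <= t)%N -> E s y (iter (z t) f x0).
  move=> st.
  have Fs : ((fun s => iter (z s) f x0) @ \oo) [set u | E s u (iter (z t) f x0)].
    exists (s + r)%N => // n /= sn; apply/Eper.
    by rewrite (zmod _ _ sn) (zmod _ _ st).
  have [u [/= uz yu]] := yP _ _ Fs (E_nbhs s y).
  exact: Etrans yu uz.
have xy : hull x0 y by move=> s; exists (z (s + r)%N); exact: yz.
exists y => //; apply/funext => s; rewrite /hull_code.
rewrite (time_mod (yz s (s + r)%N _) xy)// zmod//.
exact: leq_addr.
Qed.

Let decodeP z : odometer pow2 z ->
  hull x0 (hull_decode z) /\ hull_code (hull_decode z) = z.
Proof.
move=> /code_surj [y xy yz]; rewrite /hull_decode.
by case: xgetP => [u _ //|/(_ y)]; case.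
Qed.

Lemma hull_conjugate :
  topologically_conjugate (hull x0) f (odometer pow2) (adding_machine pow2).
Proof.
exists hull_code, hull_decode; split.
- by move=> _ [y xy <-]; exact: codeP.
- by move=> _ [z zP <-]; exact: (decodeP zP).1.
- move=> y /set_mem xy; have [h1 h2] := decodeP (codeP xy).
  exact: code_inj.
- by move=> z /set_mem zP; exact: (decodeP zP).2.
split.
- apply/subspace_continuousP => y xy; apply: cvg_coord => n.
  apply: filterS (E_nbhs n y) => u yu xu.
  by apply: class_code => //; exact: Esym.
- apply/subspace_continuousP => z zP U zU.
  have [s sU] := nbhs_class zU; have [h1 h2] := decodeP zP.
  apply: filterS (nbhs_coord z (s + r)%N) => u /= uz uP.
  have [h3 h4] := decodeP uP; apply: sU; apply: code_class => //.
  by rewrite h2 h4.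
- move=> y /set_mem xy; apply/funext => s; rewrite /adding_machine /hull_code.
  have xfy : hull x0 (f y).
    have := (minimal_hull x0).1.2; apply; by exists y.
  rewrite (@time_mod s (f y) (hull_time s y).+1 _ xfy); last first.
    by rewrite iterS; apply: Ef; exact: timeP.
  by rewrite /pow2 -[in RHS]addn1 modnDml addn1.
Qed.

End Conjugacy.
End ProfiniteOrbits.

(** * The 2-adic numbers *)

(** By Euler's theorem an odd residue modulo [2 ^ s] has its power of exponent [totient (2 ^ s) - 1]
    as inverse; uniqueness of inverses makes these residues coherent. *)
Lemma has_val0_unit (x : Z2) : has_val x 0 -> exists y, y * x = 1.
Proof.
move=> [_ /eqP x1].
have odd_x s : coprime (2 ^ s) (res x s).
  case: s => [|s]; first by rewrite expn0 coprime1n.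
  rewrite coprimeXl// coprime2n; apply: contraR x1 => xe.
  by rewrite -(res_mod_le x (ltn0Sn s)) expn1 modn2 (negbTE xe).
pose g s := (res x s ^ (totient (2 ^ s)).-1)%N.
have gE s : (g s * res x s = 1 %[mod 2 ^ s])%N.
  rewrite /g -expnSr prednK ?totient_gt0 ?expn_gt0//.
  by rewrite Euler_exp_totient// coprime_sym.
have gP s : (g s.+1 = g s %[mod 2 ^ s])%N.
  have h : (g s.+1 * res x s = 1 %[mod 2 ^ s])%N.
    have d : (2 ^ s %| 2 ^ s.+1)%N by rewrite dvdn_exp2l.
    by rewrite -(res_mod x s) modnMmr -(modn_dvdm _ d) gE modn_dvdm.
  rewrite -[in LHS](muln1 (g s.+1)) -modnMmr -(gE s) modnMmr mulnCA.
  by rewrite -modnMmr h modnMmr muln1.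
exists (mkZ2 gP); apply: resP => s.
by rewrite resM res_mkZ2 modnMml gE.
Qed.

Lemma res_exp2 k s : res (2 ^+ k) s = (2 ^ k %% 2 ^ s)%N.
Proof.
elim: k => [|k IH]; first by rewrite expr0 expn0; exact: res_mkZ2.
by rewrite exprS resM IH modnMmr resD modnMml -modnMml modnDm modnMml expnS.
Qed.

(** Division by [2 ^ k] shifts levels: residue [s] of the quotient comes from residue [s + k] of
    [x]. *)
Lemma res_eq0P (x : Z2) k : res x k = 0%N <-> exists y, x = 2 ^+ k * y.
Proof.
split=> [xk|[y ->]]; last by rewrite resM res_exp2 modnn mul0n mod0n.
have dvd s : (2 ^ k %| res x (s + k))%N.
  by rewrite /dvdn res_mod_le ?leq_addl// xk.
pose g s := (res x (s + k) %/ 2 ^ k)%N.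
have gP s : (g s.+1 = g s %[mod 2 ^ s])%N.
  apply/eqP; rewrite -(eqn_pmul2r (expn_gt0 2 k : 0 < 2 ^ k)%N).
  by rewrite !muln_modl -expnD !divnK ?dvd// addSn res_mod res_modn.
exists (mkZ2 gP); apply: resP => s.
rewrite resM res_exp2 res_mkZ2 modnMm mulnC divnK ?dvd//.
by rewrite res_mod_le// leq_addr.
Qed.

Lemma has_val_exp2 k : has_val (2 ^+ k) k.
Proof.
split; rewrite res_exp2 ?modnn// modn_small ?ltn_exp2l//.
by apply/eqP; rewrite -lt0n expn_gt0.
Qed.

Lemma toQ2_exp2 k : toQ2 (2 ^+ k) = 2 ^+ k :> Q2.
Proof. by rewrite rmorphXn /= -[2 in LHS]/(1 + 1) rmorphD rmorph1. Qed.

Lemma abs2_toQ2 (z : Z2) : z != 0 -> abs2 (toQ2 z) = 2 ^- valZ2 z.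
Proof.
move=> z0; rewrite /abs2 toQ2_eq0 (negbTE z0) -[toQ2 z]divr1 -toQ21.
rewrite val2_frac ?oner_eq0// (_ : valZ2 1 = 0%N) ?subr0 ?exprnN//.
exact: (valZ2E (has_val_exp2 0)).
Qed.

Lemma abs2_toQ2_le (z : Z2) n : (abs2 (toQ2 z) <= 2 ^- n) <-> res z n = 0%N.
Proof.
have [->|z0] := eqVneq z 0.
  by rewrite toQ20 /abs2 eqxx res0; split => // _; rewrite invr_ge0 exprn_ge0.
rewrite abs2_toQ2// lef_pV2 ?posrE ?exprn_gt0// ler_eXn2l ?ltr1n//.
have zv := valZ2P z0; split=> [nv|/has_val_le]; last exact.
exact: (res_eq0_le nv zv.1).
Qed.

Lemma abs2_exp2 n : abs2 (2 ^+ n) = 2 ^- n.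
Proof.
rewrite -toQ2_exp2 abs2_toQ2 ?(valZ2E (has_val_exp2 n))//.
exact: (has_val_neq0 (has_val_exp2 n)).
Qed.

Lemma abs2_1 : abs2 1 = 1.
Proof. by rewrite -(expr0 (2 : Q2)) abs2_exp2 invr1. Qed.

Lemma abs2_le1P (x : Q2) : abs2 x <= 1 <-> exists z, x = toQ2 z.
Proof.
split=> [|[z ->]]; last first.
  by rewrite -[1]invr1 -(expr0 2) abs2_toQ2_le; have := res_lt z 0; case: res.
have [n [d [d0 ->]]] := frac_ex x.
have [->|n0] := eqVneq n 0; first by exists 0; rewrite toQ20 mul0r.
have td : toQ2 d != 0 by rewrite toQ2_eq0.
have tn : toQ2 n != 0 by rewrite toQ2_eq0.
rewrite {1}/abs2 mulf_eq0 invr_eq0 (negbTE td) (negbTE tn) /=.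
rewrite val2_frac// -[1](expr0z 2) ler_eXz2l ?ltr1n// oppr_le0 subr_ge0 lez_nat.
have dv := valZ2P d0; set k := valZ2 d in dv * => kn.
have [u dE] := (res_eq0P d k).1 dv.1.
have [y nE] := (res_eq0P n k).1 (res_eq0_le kn (valZ2P n0).1).
have u0 : u != 0 by apply: contra d0 => /eqP u0; rewrite dE u0 mulr0.
have [v uv] := has_val_ex u0.
have v0 : v = 0%N.
  have := has_valM (has_val_exp2 k) uv; rewrite -dE => /has_val_uniq -/(_ _ dv).
  by move/eqP; rewrite -[X in _ == X]addn0 eqn_add2l => /eqP.
rewrite v0 in uv; have [w wu] := has_val0_unit uv.
exists (y * w); apply: (mulIf td); rewrite divfK//.
by rewrite -toQ2M nE dE; congr toQ2; ring: wu.
Qed.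

(** The residue field has two elements: [y / x] is a unit, hence odd, so [1 - y / x] is even. *)
Lemma abs2_sub_lt (x y : Q2) : x != 0 -> abs2 x = abs2 y ->
  abs2 (x - y) <= abs2 x / 2.
Proof.
move=> x0 xy; pose u := y / x.
have ax0 : abs2 x != 0 by rewrite abs2_eq0.
have -> : x - y = x * (1 - u) by rewrite mulrBr mulr1 mulrC divfK.
rewrite abs2M ler_wpM2l ?abs2_ge0//.
have au : abs2 u = 1.
  by apply: (mulIf ax0); rewrite -abs2M divfK// mul1r.
have [z uz] : exists z, u = toQ2 z by apply/abs2_le1P; rewrite au.
rewrite -[2^-1]/(2 ^- 1) uz -toQ21 -toQ2N -toQ2D abs2_toQ2_le.
have z1 : res z 1 <> 0%N.
  by move=> /abs2_toQ2_le; rewrite -uz au; apply/negP; rewrite -ltNge; lra.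
have {z1} z1 : res z 1 = 1%N by have := res_lt z 1; case: res z1 => [|[|]].
by have := resD (1 - z) z 1; rewrite subrK z1; have := res_lt (1 - z) 1;
  case: res => [|[|]].
Qed.

Lemma odometer_compact : compact (odometer pow2).
Proof.
have cB : compact [set z : prod_topology (fun _ : nat => nat) |
    forall i, (`I_(2 ^ i)) (z i)].
  apply: (@tychonoff nat (fun=> nat) (fun i => `I_(2 ^ i))) => i.
  exact/finite_compact/finite_II.
apply: (subclosed_compact _ cB); last by move=> z zP s; exact: (zP s).1.
move=> z zcl s; have [y [yP [/= ys ys1]]] :=
  zcl _ (filterI (nbhs_coord z s) (nbhs_coord z s.+1)).
by rewrite -ys -ys1; exact: yP.
Qed.

Lemma exp2V_lt (F : archiRealFieldType) (e : F) : 0 < e -> exists n, 2 ^- n < e.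
Proof.
move=> e0; exists (Num.Def.archi_bound e^-1).
by rewrite invf_plt ?posrE ?exprn_gt0// upper_nthrootP.
Qed.

(** The ball is the continuous image of the compact odometer under z |-> z / 2^n. Complements of
    these balls serve as neighbourhoods of infinity. *)
Lemma Q2_ball_compact n : compact [set x : Q2 | abs2 x <= 2 ^+ n].
Proof.
pose g (z : prod_topology (fun _ : nat => nat)) : Q2 :=
  if pselect (odometer pow2 z) is left zP
  then toQ2 (SigSub (mem_set zP) : Z2) / 2 ^+ n else 0.
have two0 : 2 ^+ n != 0 :> Q2 by rewrite -abs2_eq0 abs2_exp2 invr_eq0 expf_neq0.
have gE (z : Z2) : g (val z) = toQ2 z / 2 ^+ n.
  rewrite /g; case: pselect => [zP|[]]; last exact: set_valP.
  by congr (toQ2 _ / _); apply: val_inj.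
have gE' z (zP : odometer pow2 z) :
  g z = toQ2 (SigSub (mem_set zP) : Z2) / 2 ^+ n by exact: (gE (SigSub _)).
have -> : [set x : Q2 | abs2 x <= 2 ^+ n] = g @` odometer pow2.
  apply/seteqP; split => x.
    move=> /= xn; have [z zE] : exists z, x * 2 ^+ n = toQ2 z.
      by apply/abs2_le1P; rewrite abs2M abs2_exp2 ler_pdivrMr ?exprn_gt0 ?mul1r.
    exists (val z); first exact: set_valP.
    by rewrite gE -zE mulfK.
  move=> [z zP <-] /=; rewrite gE'.
  have : abs2 (toQ2 (SigSub (mem_set zP) : Z2)) <= 1.
    by apply/abs2_le1P; eexists.
  rewrite abs2M => h; rewrite -[leRHS]mul1r ler_pM ?abs2_ge0//.
  rewrite -(@ler_pM2l _ (2 ^- n)) ?invr_gt0 ?exprn_gt0//.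
  by rewrite -{1}abs2_exp2 -abs2M divff// abs2_1 mulVf// expf_neq0.
apply: continuous_compact; last exact: odometer_compact.
apply/subspace_continuousP => z zP U /nbhs_ballP[e /= e0 eU].
have [N Ne] := exp2V_lt e0.
(* Dividing by [2 ^+ n] loses [n] binary digits, so agreement is required to depth [n + N]. *)
apply: filterS (nbhs_coord z (n + N)%N) => y /= yz yP; apply: eU.
rewrite ballEmdist /=.
change (abs2 (g z - g y) < e); rewrite (gE' _ zP) (gE' _ yP).
apply: le_lt_trans Ne.
set a : Z2 := SigSub _; set b : Z2 := SigSub _.
have ab : res a (n + N) = res b (n + N) by exact: esym.
rewrite -mulrBl -toQ2N -toQ2D abs2M.
have h : abs2 (toQ2 (a - b)) <= 2 ^- (n + N).
  apply/abs2_toQ2_le; have := resD (a - b) b (n + N).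
  rewrite subrK ab => /eqP; rewrite -{1}(res_modn b) -{1}[res b _]add0n.
  by rewrite eqn_modDr mod0n res_modn => /eqP.
have q0 : 0 < abs2 (2 ^+ n)^-1 by rewrite lt_def abs2_ge0 abs2_eq0 invr_eq0 two0.
have qE : abs2 (2 ^+ n)^-1 = 2 ^+ n.
  apply: (@mulfI _ (abs2 (2 ^+ n))); first by rewrite abs2_eq0.
  by rewrite -abs2M divff// abs2_1 abs2_exp2 mulVf// expf_neq0.
apply: le_trans (ler_wpM2r (abs2_ge0 _) h) _.
by rewrite qE exprD invfM mulrC mulVKf// expf_neq0.
Qed.

(** * Ultrametric estimates in an extension of Q2 *)

Section AbsoluteValue.
Variables (R : realType) (K : fieldExtType Q2) (v : K -> R).
Hypothesis vP : extends_abs2 v.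

Local Notation iota := (in_alg K).

Lemma absK_ge0 x : 0 <= v x.
Proof. by case: vP => h _ _ _; exact: (h x).1. Qed.

Lemma absKM x y : v (x * y) = v x * v y.
Proof. by case: vP. Qed.

Lemma absK_in_alg x : v (iota x) = ratr (abs2 x).
Proof. by case: vP => _ _ _; exact. Qed.

Lemma absK_eq0 x : (v x == 0) = (x == 0).
Proof. by case: vP => h _ _ _; apply/eqP/eqP => /(h x).2. Qed.

Lemma absK0 : v 0 = 0.
Proof. by apply/eqP; rewrite absK_eq0. Qed.

Lemma absK_gt0 x : (0 < v x) = (x != 0).
Proof. by rewrite lt_def absK_ge0 absK_eq0 andbT. Qed.

Lemma absK1 : v 1 = 1.
Proof. by rewrite -(rmorph1 iota) absK_in_alg abs2_1 rmorph1. Qed.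

Lemma absKV x : v x^-1 = (v x)^-1.
Proof.
have [->|x0] := eqVneq x 0; first by rewrite invr0 absK0 invr0.
by apply: (mulIf (_ : v x != 0)); rewrite ?absK_eq0// -absKM !mulVf ?absK_eq0// absK1.
Qed.

Lemma absKf x y : v (x / y) = v x / v y.
Proof. by rewrite absKM absKV. Qed.

Lemma absKX x n : v (x ^+ n) = v x ^+ n.
Proof. by elim: n => [|n IH]; rewrite ?expr0 ?absK1// !exprS absKM IH. Qed.

Lemma absKN x : v (- x) = v x.
Proof.
apply/eqP; rewrite -(@eqrXn2 _ 2) ?absK_ge0//.
by rewrite -!absKX sqrrN.
Qed.

Lemma absKB x y : v (x - y) = v (y - x).
Proof. by rewrite -absKN opprB. Qed.

Lemma absKD_le x y e : v x <= e -> v y <= e -> v (x + y) <= e.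
Proof.
case: vP => _ _ h _ xe ye; apply: le_trans (h x y) _.
by rewrite ge_max xe.
Qed.

Lemma absKB_le x y e : v x <= e -> v y <= e -> v (x - y) <= e.
Proof. by move=> xe ye; apply: absKD_le; rewrite ?absKN. Qed.

Lemma absK_sub_trans y x z e : v (x - y) <= e -> v (y - z) <= e -> v (x - z) <= e.
Proof. by move=> xy yz; rewrite -(subrKA y); exact: absKD_le. Qed.

Lemma absKD_lt x y : v y < v x -> v (x + y) = v x.
Proof.
move=> yx; apply/eqP; rewrite eq_le; apply/andP; split.
  by apply: absKD_le => //; exact: ltW.
have [//|xyx] := leP (v x) (v (x + y)).
suff : v x < v x by rewrite ltxx.
rewrite -{1}(addrK y x); case: vP => _ _ h _; apply: le_lt_trans (h _ _) _.
by rewrite gt_max xyx absKN.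
Qed.

Lemma absK2 : v 2 = 2^-1.
Proof.
rewrite -(rmorph_nat iota) absK_in_alg.
by rewrite -[X in abs2 X]expr1 abs2_exp2 expr1 fmorphV rmorph_nat.
Qed.

Lemma absK_in_alg_exp (x : Q2) : x != 0 -> exists k : int, v (iota x) = 2 ^ k.
Proof.
move=> x0; exists (- val2 x); rewrite absK_in_alg /abs2 (negbTE x0).
by rewrite fmorphXz rmorph_nat.
Qed.

Lemma absK_in_alg_sub (x y : Q2) : x != 0 -> v (iota x) = v (iota y) ->
  v (iota (x - y)) <= v (iota x) / 2.
Proof.
rewrite !absK_in_alg => x0 /fmorph_inj xy.
have -> : ratr (abs2 x) / 2 = ratr (abs2 x / 2) :> R by rewrite fmorph_div rmorph_nat.
by rewrite ler_rat abs2_sub_lt.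
Qed.

Lemma absK_in_alg_lt1 (x : Q2) : v (iota x) < 1 -> v (iota x) <= 2^-1.
Proof.
have [->|/absK_in_alg_exp[k ->]] := eqVneq x 0.
  by rewrite rmorph0 absK0 invr_ge0.
rewrite -[X in _ < X -> _](expr0z 2) ltr_eXz2l ?ltr1n// => k0.
by rewrite -[_^-1]/(2 ^ (-1)) ler_eXz2l ?ltr1n//; lia.
Qed.

Lemma absK_in_alg_gt1 (x : Q2) : 1 < v (iota x) ->
  exists2 m : nat, (0 < m)%N & v (iota x) = 2 ^+ m.
Proof.
have [->|/absK_in_alg_exp[k ->]] := eqVneq x 0.
  by rewrite rmorph0 absK0 ltr10.
rewrite -[X in X < _ -> _](expr0z 2) ltr_eXz2l ?ltr1n//.
by case: k => // m; exists m.
Qed.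

(** * Congruences between powers of units *)

Section UnitCongruences.
Implicit Types x y z w : K.

Lemma absK_sub_unitl z x y : v z = 1 -> v (z * x - z * y) = v (x - y).
Proof. by move=> z1; rewrite -mulrBr absKM z1 mul1r. Qed.

Lemma absK_sub_mul x x' y y' e : v x = 1 -> v y' = 1 ->
  v (x - x') <= e -> v (y - y') <= e -> v (x * y - x' * y') <= e.
Proof.
move=> x1 y1 xx yy; apply: (@absK_sub_trans (x * y')).
  by rewrite absK_sub_unitl.
by rewrite ![_ * y']mulrC absK_sub_unitl.
Qed.

Lemma absK_sub_exp x y e n : v x = 1 -> v y = 1 ->
  v (x - y) <= e -> v (x ^+ n - y ^+ n) <= e.
Proof.
move=> x1 y1 xy; elim: n => [|n IH].
  by rewrite !expr0 subrr absK0 (le_trans (absK_ge0 _) xy).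
by rewrite !exprS; apply: absK_sub_mul => //; rewrite absKX y1 expr1n.
Qed.

Lemma absK_exp_sub x i j : v x = 1 -> (i <= j)%N ->
  v (x ^+ i - x ^+ j) = v (x ^+ (j - i) - 1).
Proof.
move=> x1 ij; rewrite -{1}(subnKC ij) exprD -{1}[x ^+ i]mulr1.
by rewrite absK_sub_unitl 1?absKB// absKX x1 expr1n.
Qed.

Lemma absK_near1 x e : v (x - 1) <= e -> e < 1 -> v x = 1.
Proof.
by move=> xe e1; rewrite -(subrK 1 x) addrC absKD_lt absK1// (le_lt_trans xe).
Qed.

Lemma absK_sqr_sub1 w : v (w - 1) <= 2 ^- 2 -> v (w ^+ 2 - 1) = v (w - 1) / 2.
Proof.
move=> w4; rewrite subr_sqr_1 absKM; congr (_ * _).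
have -> : w + 1 = 2 + (w - 1) by ring.
by rewrite absKD_lt absK2//; apply: le_lt_trans w4 _; lra.
Qed.

Lemma absK_odd_nat n : odd n -> v n%:R = 1.
Proof.
move=> no; have := odd_double_half n; rewrite no => <-.
rewrite natrD absKD_lt absK1// -muln2 natrM absKM absK2.
suff : v n./2%:R <= 1 by move=> h; lra.
elim: n./2 => [|m IH]; first by rewrite absK0 ler01.
by rewrite -addn1 natrD; apply: absKD_le; rewrite ?absK1.
Qed.

(** The geometric sum multiplying [w - 1] is congruent to [n] up to 1/4, and an odd [n] is a
    unit. *)
Lemma absK_odd_exp_sub1 w n : v (w - 1) <= 2 ^- 2 -> odd n ->
  v (w ^+ n - 1) = v (w - 1).
Proof.
move=> w4 no; rewrite subrX1 absKM -[RHS]mulr1; congr (_ * _).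
have w1 : v w = 1 by apply: absK_near1 w4 _; lra.
rewrite -(absK_odd_nat no).
have -> : \sum_(i < n) w ^+ i = n%:R + \sum_(i < n) (w ^+ i - 1).
  by rewrite sumrB big_const_ord iter_addr_0 addrC subrK.
apply: absKD_lt; rewrite absK_odd_nat//.
apply: (@le_lt_trans _ _ (2 ^- 2)); last lra.
elim/big_ind: _ => [|x y|i _]; first by rewrite absK0; lra.
- exact: absKD_le.
- by rewrite -[X in _ - X](expr1n _ i) absK_sub_exp// absK1.
Qed.

(** Lifting the exponent: the odd part of [j] leaves the distance to 1 unchanged, and each factor 2
    halves it. *)
Lemma absK_exp_sub1 w q j n : v (w - 1) = 2 ^- q -> (2 <= q)%N ->
  (v (w ^+ j - 1) <= 2 ^- (q + n)) = (2 ^ n %| j)%N.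
Proof.
move=> wq q2.
have [->|j0] := posnP j.
  by rewrite expr0 subrr absK0 dvdn0 invr_ge0 exprn_ge0.
have le2 k : 2 ^- (q + k) <= 2 ^- 2 :> R.
  by rewrite lef_pV2 ?posrE ?exprn_gt0// ler_eXn2l ?ltr1n// (leq_trans q2) ?leq_addr.
have w4 : v (w - 1) <= 2 ^- 2 by rewrite wq -[q]addn0.
have dbl k : v (w ^+ (2 ^ k) - 1) = 2 ^- (q + k).
  elim: k => [|k IH]; first by rewrite expn0 expr1 addn0.
  by rewrite expnSr exprM absK_sqr_sub1 IH// addnS exprSr invfM.
have [m m2 jE] := pfactor_coprime (isT : prime 2) j0.
rewrite pfactor_dvdn// {1}jE mulnC exprM absK_odd_exp_sub1 ?dbl//; last first.
  by rewrite coprime2n in m2.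
by rewrite lef_pV2 ?posrE ?exprn_gt0// ler_eXn2l ?ltr1n// leq_add2l.
Qed.

Lemma absK_exp_congr w q i j n : v (w - 1) = 2 ^- q -> (2 <= q)%N ->
  (v (w ^+ i - w ^+ j) <= 2 ^- (q + n)) = (i == j %[mod 2 ^ n]).
Proof.
move=> wq q2; wlog ij : i j / (i <= j)%N.
  by move=> h; have [/h//|/ltnW/h] := leqP i j; rewrite absKB eq_sym.
have w1 : v w = 1.
  apply: (@absK_near1 _ (2 ^- 2)); last by lra.
  by rewrite wq lef_pV2 ?posrE ?exprn_gt0// ler_eXn2l ?ltr1n.
by rewrite absK_exp_sub// (absK_exp_sub1 _ _ wq q2) eq_sym eqn_mod_dvd.
Qed.

End UnitCongruences.

(** * The norm-one group of Q2(s) *)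

Section NormOneGroup.
Variable s : K.
Hypothesis sP : s ^+ 2 = -1 \/ s ^+ 2 = 3.

Let iotaD x y : iota (x + y) = iota x + iota y. Proof. exact: rmorphD. Qed.
Let iotaB x y : iota (x - y) = iota x - iota y. Proof. exact: rmorphB. Qed.
Let iotaN x : iota (- x) = - iota x. Proof. exact: rmorphN. Qed.
Let iotaM x y : iota (x * y) = iota x * iota y. Proof. exact: rmorphM. Qed.
Let iotaV x : iota x^-1 = (iota x)^-1. Proof. exact: fmorphV. Qed.
Let iota0 : iota 0 = 0. Proof. exact: rmorph0. Qed.
Let iota1 : iota 1 = 1. Proof. exact: rmorph1. Qed.
Let iota_nat n : iota n%:R = n%:R. Proof. exact: rmorph_nat. Qed.
Let iota_eq0 x : (iota x == 0) = (x == 0). Proof. exact: fmorph_eq0. Qed.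

Lemma absK_sqrt : v s = 1.
Proof.
apply/eqP; rewrite -(@eqrXn2 _ 2) ?absK_ge0// expr1n -absKX.
case: sP => ->; first by rewrite absKN absK1.
by rewrite (@absK_odd_nat 3).
Qed.

(** In (1 - s)^2 = -2s + (1 + s^2) the first term dominates, since 1 + s^2 is 0 or 4. So [1 - s] has
    half the valuation of 2 and will serve as a uniformizer. *)
Lemma absK_1sub_sqr : v (1 - s) ^+ 2 = 2^-1.
Proof.
rewrite -absKX; have -> : (1 - s) ^+ 2 = - (2 * s) + (1 + s ^+ 2) by ring.
have vs2 : v (2 * s) = 2^-1 by rewrite absKM absK2 absK_sqrt mulr1.
rewrite absKD_lt absKN vs2//; case: sP => ->.
  by rewrite subrr absK0 invr_gt0.
have -> : 1 + 3 = 2 * 2 :> K by ring.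
by rewrite absKM absK2; lra.
Qed.

Lemma absK_1sub_gt0 : 0 < v (1 - s).
Proof.
rewrite lt_def absK_ge0 andbT; apply/eqP => h.
by have := absK_1sub_sqr; rewrite h expr0n; apply/eqP; rewrite eq_sym invr_eq0.
Qed.

Lemma absK_1sub_half : 2^-1 < v (1 - s).
Proof.
rewrite ltNge; apply/negP => h; have := absK_1sub_sqr.
have := absK_1sub_gt0; nra.
Qed.

Lemma absK_1sub_lt1 : v (1 - s) < 1.
Proof. by rewrite ltNge; apply/negP => h; have := absK_1sub_sqr; nra. Qed.

Lemma absK_in_alg_N (t : Q2) : v (iota (- t)) = v (iota t).
Proof. by rewrite iotaN absKN. Qed.

Lemma absK_shift_gt1 t : 1 < v (iota t) -> v (iota t - s) = v (iota t).
Proof. by move=> t1; rewrite absKD_lt// absKN absK_sqrt. Qed.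

Lemma absK_shift_lt1 t : v (iota t) < 1 -> v (iota t - s) = 1.
Proof. by move=> t1; rewrite addrC absKD_lt absKN absK_sqrt. Qed.

Lemma absK_shift_eq1 t : v (iota t) = 1 -> v (iota t - s) = v (1 - s).
Proof.
move=> t1; have -> : iota t - s = (1 - s) + (iota t - 1) by ring.
rewrite absKD_lt// (le_lt_trans _ absK_1sub_half)//.
have := @absK_in_alg_sub t 1; rewrite iotaB iota1 absK1 t1 mul1r. apply=> //.
by rewrite -iota_eq0 -absK_eq0 t1 oner_eq0.
Qed.

(** A lower bound uniform in [t]: it shows that [s] is not in Q2, and it bounds the denominators in
    [absK_cayley_sub] away from 0. *)
Lemma absK_shift_ge t : v (1 - s) <= v (iota t - s).
Proof.
have := absK_1sub_lt1; have [t1|t1|t1] := ltgtP (v (iota t)) 1.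
- by rewrite absK_shift_lt1//; exact: ltW.
- by rewrite absK_shift_gt1// => h; apply: ltW (lt_trans h t1).
- by rewrite absK_shift_eq1.
Qed.

Lemma shift_neq0 t : iota t - s != 0.
Proof. by rewrite -absK_gt0 (lt_le_trans absK_1sub_gt0)// absK_shift_ge. Qed.

(** Invariance of the absolute value under s |-> -s, obtained from t |-> -t because |t - s| depends
    only on |t|. *)
Lemma absK_shiftD t : v (iota t + s) = v (iota t - s).
Proof.
have -> : iota t + s = - (iota (- t) - s) by rewrite iotaN; ring.
rewrite absKN; have tN := absK_in_alg_N t.
have [t1|t1|t1] := ltgtP (v (iota t)) 1.
- by rewrite !absK_shift_lt1 ?tN.
- by rewrite !absK_shift_gt1 ?tN.
- by rewrite !absK_shift_eq1 ?tN.
Qed.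

Lemma shiftD_neq0 t : iota t + s != 0.
Proof. by rewrite -absK_gt0 absK_shiftD absK_gt0 shift_neq0. Qed.

(** The quotient of [t + s] by its conjugate. The value 1 is missed: it belongs to t = infinity. *)
Definition cayley (t : Q2) : K := (iota t + s) / (iota t - s).

(* The group of norm-one elements of Q2(s), parametrized by Hilbert 90. *)
Definition norm1 (u : K) : Prop := u = 1 \/ exists t, u = cayley t.

Lemma absK_cayley t : v (cayley t) = 1.
Proof. by rewrite absKf absK_shiftD divff// absK_eq0 shift_neq0. Qed.

Lemma absK_norm1 u : norm1 u -> v u = 1.
Proof. by case=> [->|[t ->]]; rewrite ?absK1 ?absK_cayley. Qed.

Lemma norm1_neq0 u : norm1 u -> u != 0.
Proof. by move=> /absK_norm1 u1; rewrite -absK_eq0 u1 oner_eq0. Qed.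

Lemma norm11 : norm1 1. Proof. by left. Qed.

Lemma cayleyN_mul t : cayley t * cayley (- t) = 1.
Proof.
have := shift_neq0 t; have := shiftD_neq0 t; rewrite /cayley iotaN.
by move: (iota t) => x n1 n2; field; rewrite n2 -opprD oppr_eq0 n1.
Qed.

(** The addition law of a cotangent, read off (t + s)(t' + s) = (t t' + s^2) + (t + t') s. *)
Lemma cayleyM D t t' : iota D = s ^+ 2 -> t + t' != 0 ->
  cayley t * cayley t' = cayley ((t * t' + D) / (t + t')).
Proof.
move=> DE tt; have n1 := shift_neq0 t; have n2 := shift_neq0 t'.
have itt : iota t + iota t' != 0 by rewrite -iotaD iota_eq0.
have n4 := shift_neq0 ((t * t' + D) / (t + t')).
have E : iota ((t * t' + D) / (t + t')) =
    (iota t * iota t' + s ^+ 2) / (iota t + iota t').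
  by rewrite iotaM iotaV !iotaD iotaM -DE.
rewrite /cayley E in n4 *; field; rewrite n1 n2 itt /= andbT mulNr.
by have := mulf_neq0 n4 itt; rewrite mulrBl divfK.
Qed.

Lemma norm1M u w : norm1 u -> norm1 w -> norm1 (u * w).
Proof.
case=> [->|[t ->]]; first by rewrite mul1r.
case=> [->|[t' ->]]; first by rewrite mulr1; right; exists t.
have [D DE] : exists D : Q2, iota D = s ^+ 2.
  by case: sP => ->; [exists (-1); rewrite iotaN iota1|exists 3; rewrite iota_nat].
have [tt|tt] := eqVneq (t + t') 0; last by right; rewrite (cayleyM DE)//; eexists.
by left; move: tt => /eqP; rewrite addrC addr_eq0 => /eqP ->; exact: cayleyN_mul.
Qed.

Lemma norm1V u : norm1 u -> norm1 u^-1.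
Proof.
case=> [->|[t ->]]; [by left; rewrite invr1|right; exists (- t)].
have := shift_neq0 t; have := shiftD_neq0 t; rewrite /cayley iotaN.
by move: (iota t) => x n1 n2; field; rewrite -opprD oppr_eq0 n1 n2.
Qed.

Lemma norm1X u n : norm1 u -> norm1 (u ^+ n).
Proof.
move=> nu; elim: n => [|n IH]; first exact: norm11.
by rewrite exprS; exact: norm1M.
Qed.

Lemma absK_cayley_sub1 t : v (cayley t - 1) = 2^-1 / v (iota t - s).
Proof.
have n1 := shift_neq0 t.
have -> : cayley t - 1 = 2 * s / (iota t - s).
  by rewrite /cayley; move: (iota t) n1 => x n1; field.
by rewrite absKf absKM absK2 absK_sqrt mulr1.
Qed.

Lemma absK_cayley_sub t t' : v (cayley t - cayley t') =
  2^-1 * v (iota (t - t')) / (v (iota t - s) * v (iota t' - s)).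
Proof.
have n1 := shift_neq0 t; have n2 := shift_neq0 t'.
have -> : cayley t - cayley t' =
    2 * s * iota (t' - t) / ((iota t - s) * (iota t' - s)).
  rewrite /cayley iotaB; move: (iota t) (iota t') n1 n2 => x y n1 n2.
  by field; rewrite n1 n2.
by rewrite absKf !absKM absK2 absK_sqrt mulr1 iotaB absKB -iotaB.
Qed.

Lemma absK_cayley_near1 t : v (cayley t - 1) <= 2 ^- 2 -> 1 < v (iota t).
Proof.
rewrite absK_cayley_sub1 ler_pdivrMr; last first.
  by rewrite absK_gt0 shift_neq0.
move=> h; have ts : 2 <= v (iota t - s) by lra.
rewrite ltNge; apply/negP => t1.
have : v (iota t - s) <= 1 by apply: absKB_le; rewrite ?absK_sqrt.
by lra.
Qed.

Lemma absK_cayley_sub1_big t m : v (iota t) = 2 ^+ m -> (0 < m)%N ->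
  v (cayley t - 1) = 2 ^- m.+1.
Proof.
move=> tm m0; rewrite absK_cayley_sub1 absK_shift_gt1 tm.
  by rewrite exprS invfM.
by rewrite exprn_egt1 ?ltr1n// -lt0n.
Qed.

(** Within 1/4 of 1 the parameter has |t| > 1, so |t - s| = |t| is an integer power of 2 and the
    half-integral values of K do not occur. *)
Lemma norm1_sub1_val u : norm1 u -> u != 1 -> v (u - 1) <= 2 ^- 2 ->
  exists2 q, (2 <= q)%N & v (u - 1) = 2 ^- q.
Proof.
case=> [->|[t ->]]; first by rewrite eqxx.
move=> _ /absK_cayley_near1 /absK_in_alg_gt1[m m0 tm].
by exists m.+1 => //; exact: absK_cayley_sub1_big.
Qed.

(* Each filtration step of the norm-one group has index 2 because the residue
   field of Q2 has two elements. *)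
Lemma norm1_same_level u w m : norm1 u -> norm1 w -> (2 <= m)%N ->
  v (u - 1) = 2 ^- m -> v (w - 1) = 2 ^- m -> v (u - w) <= 2 ^- m.+1.
Proof.
move=> nu nw m2 um wm.
have big z : norm1 z -> v (z - 1) = 2 ^- m ->
    exists t, z = cayley t /\ v (iota t) = 2 ^+ m.-1.
  move=> [->|[t ->]].
    by rewrite subrr absK0 => /esym/eqP; rewrite invr_eq0 expf_eq0 pnatr_eq0 andbF.
  move=> tm; exists t; split=> //.
  have t1 : 1 < v (iota t).
    by apply: absK_cayley_near1; rewrite tm lef_pV2 ?posrE ?exprn_gt0// ler_eXn2l ?ltr1n.
  have [k k0 tk] := absK_in_alg_gt1 t1.
  have := absK_cayley_sub1_big tk k0; rewrite tm => /invr_inj.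
  by move=> /(ieexprIn _ _) ->; rewrite ?pnatr_eq1.
have [t [-> tm]] := big _ nu um; have [t' [-> tm']] := big _ nw wm.
case: m m2 {um wm big} tm tm' => [|[|m]]// _ /= tm tm'.
have t1 : 1 < v (iota t) by rewrite tm exprn_egt1 ?ltr1n.
have t1' : 1 < v (iota t') by rewrite tm' exprn_egt1 ?ltr1n.
rewrite absK_cayley_sub !absK_shift_gt1//.
rewrite ler_pdivrMr ?mulr_gt0 ?(lt_trans _ t1) ?(lt_trans _ t1')//.
have t0 : t != 0 by apply: contraTneq t1 => ->; rewrite iota0 absK0 ltr10.
have := absK_in_alg_sub t0 (etrans tm (esym tm')).
have p : 0 < 2 ^+ m :> R by rewrite exprn_gt0.
rewrite tm tm' !exprS => h; apply: le_trans (ler_wpM2l _ h) _; first by lra.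
rewrite le_eqVlt; apply/orP; left; apply/eqP; field.
by rewrite gt_eqF.
Qed.

(** The binary digits of [j] are found one at a time. If [u / w ^+ j] misses level q + n + 1, it
    lies exactly at level q + n, as does [w ^+ (2 ^ n)]; by [norm1_same_level] the exponent
    [j + 2 ^ n] then works. *)
Lemma norm1_cover u w q : norm1 u -> norm1 w -> (2 <= q)%N ->
  v (w - 1) = 2 ^- q -> v (u - 1) <= 2 ^- q ->
  forall n, exists2 j, (j < 2 ^ n)%N & v (u - w ^+ j) <= 2 ^- (q + n).
Proof.
move=> nu nw q2 wq uq; elim=> [|n [j jn uj]].
  by exists 0%N; rewrite // expr0 addn0.
have [uj'|uj'] := leP (v (u - w ^+ j)) (2 ^- (q + n.+1)).
  by exists j => //; rewrite (leq_trans jn)// leq_exp2l.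
have nwj := norm1X j nw; have wj1 := absK_norm1 nwj.
pose z := u / w ^+ j; have nz : norm1 z by apply: norm1M => //; exact: norm1V.
have zE x : v (u - w ^+ j * x) = v (z - x).
  by rewrite -(absK_sub_unitl z x wj1) /z [_ * (_ / _)]mulrC divfK// norm1_neq0.
have zq : v (z - 1) = v (u - w ^+ j) by rewrite -zE mulr1.
have le2 k : 2 ^- (q + k) <= 2 ^- 2 :> R.
  by rewrite lef_pV2 ?posrE ?exprn_gt0// ler_eXn2l ?ltr1n// (leq_trans q2) ?leq_addr.
have zqn : v (z - 1) = 2 ^- (q + n).
  have [||k k2 zk] := norm1_sub1_val nz.
  - apply: contraTneq uj' => z1; rewrite -zq z1 subrr absK0 -leNgt.
    by rewrite invr_ge0 exprn_ge0.
  - by rewrite zq; apply: le_trans uj (le2 _).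
  have := uj; have := uj'; rewrite -zq zk.
  rewrite lef_pV2 ?ltf_pV2 ?posrE ?exprn_gt0// ler_eXn2l ?ltr_eXn2l ?ltr1n//.
  rewrite addnS ltnS => h1 h2.
  by have -> : k = (q + n)%N by apply/eqP; rewrite eqn_leq h1.
have wn : v (w ^+ (2 ^ n) - 1) = 2 ^- (q + n).
  have := absK_exp_sub1 (2 ^ n) n wq q2; rewrite dvdnn => h1.
  have := absK_exp_sub1 (2 ^ n) n.+1 wq q2.
  rewrite (dvdn_Pexp2l n.+1 n (isT : 1 < 2)%N) ltnn => h2.
  have [||k k2 wk] := norm1_sub1_val (norm1X (2 ^ n) nw).
  - by apply: contraFneq h2 => ->; rewrite subrr absK0 invr_ge0 exprn_ge0.
  - by apply: le_trans h1 (le2 _).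
  move: h1 h2; rewrite wk !lef_pV2 ?posrE ?exprn_gt0// !ler_eXn2l ?ltr1n//.
  rewrite addnS => h1 /negbT; rewrite -ltnNge ltnS => h2.
  by have -> : k = (q + n)%N by apply/eqP; rewrite eqn_leq h1 h2.
exists (j + 2 ^ n)%N; first by rewrite expnS mul2n -addnn ltn_add2r.
rewrite exprD zE addnS; apply: norm1_same_level => //; first exact: norm1X.
by rewrite (leq_trans q2)// leq_addr.
Qed.

(** * The norm-one group modulo W_2 *)

Definition gen4 : K := cayley 1.

Lemma norm1_gen4 : norm1 gen4. Proof. by right; exists 1. Qed.

Lemma absK_cayley_even t : v (iota t) < 1 -> v (cayley t + 1) <= 2 ^- 2.
Proof.
move=> t1; have n1 := shift_neq0 t.
have -> : cayley t + 1 = 2 * iota t / (iota t - s).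
  by rewrite /cayley; move: (iota t) n1 => x n1; field.
rewrite absKf absK_shift_lt1// divr1 absKM absK2.
by have := absK_in_alg_lt1 t1; lra.
Qed.

(** The sum equals 2(1 + s^2)/(1 - s)^2. It vanishes if s^2 = -1, where [gen4] is [s] itself; if s^2
    = 3 its absolute value is exactly 1/4. *)
Lemma gen4_sqr : v (gen4 ^+ 2 + 1) <= 2 ^- 2.
Proof.
have n1 := shift_neq0 1; rewrite iota1 in n1.
rewrite /gen4 /cayley iota1.
have -> : ((1 + s) / (1 - s)) ^+ 2 + 1 = 2 * (1 + s ^+ 2) / (1 - s) ^+ 2 by field.
rewrite absKf absKX absK_1sub_sqr absKM absK2.
case: sP => ->; first by rewrite subrr absK0; lra.
have -> : 1 + 3 = 2 * 2 :> K by ring.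
by rewrite absKM absK2; lra.
Qed.

Lemma gen4_exp4 : v (gen4 ^+ 4 - 1) <= 2 ^- 2.
Proof.
have -> : gen4 ^+ 4 - 1 = (gen4 ^+ 2 + 1) * (gen4 ^+ 2 - 1) by ring.
rewrite absKM -[leRHS]mulr1 ler_pM ?absK_ge0 ?gen4_sqr//.
by apply: absKB_le; rewrite ?absKX ?absK1 // (absK_norm1 norm1_gen4) expr1n.
Qed.

Lemma gen4_exp_far a : (0 < a < 4)%N -> 2 ^- 2 < v (gen4 ^+ a - 1).
Proof.
have n1 := shift_neq0 1; rewrite iota1 in n1.
have b := absK_1sub_half; have b1 := absK_1sub_lt1.
have g1 : v gen4 = 1 := absK_norm1 norm1_gen4.
have inv : 2^-1 / v (1 - s) > 2 ^- 2.
  by rewrite ltr_pdivlMr ?absK_1sub_gt0//; lra.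
case: a => [|[|[|[|]]]]// _.
- by rewrite expr1 absK_cayley_sub1 iota1.
- have -> : gen4 ^+ 2 - 1 = - 2 + (gen4 ^+ 2 + 1) by ring.
  by rewrite absKD_lt absKN absK2 ?(le_lt_trans gen4_sqr)//; lra.
- have -> : gen4 ^+ 3 - 1 = - (gen4 + 1) + gen4 * (gen4 ^+ 2 + 1) by ring.
  have g4 : v (gen4 + 1) = 2^-1 / v (1 - s).
    have -> : gen4 + 1 = 2 / (1 - s) by rewrite /gen4 /cayley iota1; field.
    by rewrite absKf absK2.
  by rewrite absKD_lt absKN g4// absKM g1 mul1r (le_lt_trans gen4_sqr).
Qed.

Lemma gen4_congr a b : (v (gen4 ^+ a - gen4 ^+ b) <= 2 ^- 2) = (a == b %[mod 4]).
Proof.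
wlog ab : a b / (a <= b)%N.
  move=> h; have [/h//|/ltnW/h] := leqP a b.
  by rewrite absKB eq_sym.
have g1 : v gen4 = 1 := absK_norm1 norm1_gen4.
rewrite (absK_exp_sub g1 ab) eq_sym eqn_mod_dvd//.
set c := (b - a)%N; rewrite (divn_eq c 4).
set r := (c %% 4)%N; set k := (c %/ 4)%N.
have h : v (gen4 ^+ (k * 4 + r) - gen4 ^+ r) <= 2 ^- 2.
  rewrite exprD -[X in _ - X]mul1r ![_ * gen4 ^+ r]mulrC absK_sub_unitl.
    rewrite mulnC exprM -[X in _ - X](expr1n _ k) absK_sub_exp ?absK1 ?gen4_exp4//.
    by rewrite absKX g1 expr1n.
  by rewrite absKX g1 expr1n.
rewrite dvdn_addr ?dvdn_mull//; have [r0|r0] := posnP r.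
  by rewrite r0 dvdn0 addn0; move: h; rewrite r0 addn0 expr0.
have r4 : (r < 4)%N by rewrite ltn_mod.
rewrite gtnNdvd//; apply/negbTE; rewrite -ltNge.
rewrite (_ : _ - 1 = (gen4 ^+ r - 1) + (gen4 ^+ (k * 4 + r) - gen4 ^+ r)); last by ring.
by rewrite absKD_lt ?gen4_exp_far ?r0// (le_lt_trans h)// gen4_exp_far// r0.
Qed.

(** The class can be read off the parameter: exponent 0 for |t| > 1, 2 for |t| < 1, and 1 or 3 for t
    congruent to 1 or -1 modulo 4. *)
Lemma norm1_mod4 u : norm1 u -> exists a, v (u - gen4 ^+ a) <= 2 ^- 2.
Proof.
case=> [->|[t ->]].
  by exists 0%N; rewrite expr0 subrr absK0 invr_ge0 exprn_ge0.
have [t1|t1|t1] := ltgtP (v (iota t)) 1.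
- exists 2%N; apply: (@absK_sub_trans (- 1)).
    by rewrite opprK absK_cayley_even.
  by rewrite -opprD absKN addrC gen4_sqr.
- have [m m0 tm] := absK_in_alg_gt1 t1; exists 0%N.
  rewrite expr0 (absK_cayley_sub1_big tm m0).
  by rewrite lef_pV2 ?posrE ?exprn_gt0// ler_eXn2l ?ltr1n.
- have t0 : t != 0 by apply: contra_eq_neq t1 => ->; rewrite iota0 absK0 eq_sym oner_eq0.
  have i1 : v (iota 1) = 1 by rewrite iota1 absK1.
  (* For units [t] and [e] both denominators have absolute value |1 - s|; their product 1/2 cancels
     the factor 1/2, so [cayley] preserves the distance. *)
  have sub1 (e : Q2) : v (iota e) = 1 -> v (iota (t - e)) <= 2 ^- 2 ->
      v (cayley t - cayley e) <= 2 ^- 2.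
    move=> e1 te; rewrite absK_cayley_sub !absK_shift_eq1// -expr2 absK_1sub_sqr.
    by rewrite mulrAC divff ?mul1r// invr_eq0.
  have te : v (iota (t - 1)) <= 2^-1.
    by have := absK_in_alg_sub t0 (etrans t1 (esym i1)); rewrite t1 mul1r.
  have [te2|te2] := leP (v (iota (t - 1))) (2 ^- 2).
    by exists 1%N; rewrite expr1; exact: sub1.
  exists 3%N; apply: (@absK_sub_trans (cayley (-1))).
    apply: sub1; first by rewrite absK_in_alg_N.
    have tem : v (iota (t - 1)) = 2^-1.
      have [e0|/absK_in_alg_exp[k tk]] := eqVneq (t - 1) 0.
        by rewrite e0 iota0 absK0 in te2; move: te2; rewrite ltNge invr_ge0 exprn_ge0.
      move: te te2; rewrite tk exprnN -[_^-1]/(2 ^ (-1)) ler_eXz2l ?ltr_eXz2l ?ltr1n//.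
      by move=> h1 h2; have -> : k = -1 by lia.
    have t10 : t - 1 != 0 by rewrite -(iota_eq0) -absK_eq0 tem invr_eq0.
    have := @absK_in_alg_sub (t - 1) (- 2) t10.
    rewrite absK_in_alg_N iota_nat absK2 tem => /(_ erefl).
    have -> : t - 1 - -2 = t - -1 by ring.
    by lra.
  (* [cayley (-1)] is the inverse of [gen4], hence congruent to its cube. *)
  rewrite -(@absK_sub_unitl gen4) ?(absK_norm1 norm1_gen4)//.
  have -> : gen4 * cayley (- 1) = 1.
    have := shift_neq0 1; have := shiftD_neq0 1.
    rewrite /gen4 /cayley iotaN iota1 => n1 n2.
    by field; rewrite n2 -opprD oppr_eq0 n1.
  by rewrite -exprS absKB gen4_exp4.
Qed.

(** * Orbits of multiplication by l on the norm-one group *)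

Section Rotation.
Variables (l : K) (r o q : nat).
Hypotheses (nl : norm1 l) (r2 : (r <= 2)%N) (oo : odd o) (q2 : (2 <= q)%N).
Hypothesis l_mod4 : v (l - gen4 ^+ (2 ^ (2 - r) * o)) <= 2 ^- 2.
Hypothesis l_exact : v (l ^+ (2 ^ r) - 1) = 2 ^- q.

Let l1 : v l = 1. Proof. exact: absK_norm1. Qed.
Let g1 : v gen4 = 1. Proof. exact: absK_norm1 norm1_gen4. Qed.

Let le_q2 n : 2 ^- (q + n) <= 2 ^- 2 :> R.
Proof.
by rewrite lef_pV2 ?posrE ?exprn_gt0// ler_eXn2l ?ltr1n// (leq_trans q2)// leq_addr.
Qed.

Let pow4 : (2 ^ (2 - r) * 2 ^ r = 4)%N.
Proof. by rewrite -expnD subnK. Qed.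

Let l_gen4 n : v (l ^+ n - gen4 ^+ (2 ^ (2 - r) * o * n)) <= 2 ^- 2.
Proof. by rewrite exprM absK_sub_exp// absKX g1 expr1n. Qed.

Let mod4_cancel n m : (2 ^ (2 - r) * o * n == 2 ^ (2 - r) * o * m %[mod 4])%N ->
  (n == m %[mod 2 ^ r])%N.
Proof.
wlog nm : n m / (m <= n)%N.
  by move=> h; have [/h h1|/ltnW/h//] := leqP n m; rewrite eq_sym => /h1; rewrite eq_sym.
rewrite !eqn_mod_dvd ?leq_mul2l ?nm ?orbT// -mulnBr -{1}pow4 -mulnA.
by rewrite dvdn_pmul2l ?expn_gt0// Gauss_dvdr// coprimeXl// coprime2n.
Qed.

(** Congruence at level q + n implies congruence modulo W_2, where [l] has order [2 ^ r]. Hence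
    [2 ^ r] divides the difference of exponents, and lifting the exponent applies to
    [l ^+ (2 ^ r)]. *)
Lemma rotation_period i j n :
  v (l ^+ i - l ^+ j) <= 2 ^- (q + n) <-> i = j %[mod 2 ^ (n + r)].
Proof.
wlog ij : i j / (i <= j)%N.
  move=> h; have [/h//|/ltnW/h] := leqP i j.
  by rewrite absKB => ->; split => /esym.
rewrite absK_exp_sub//; set c := (j - i)%N.
have -> : (i = j %[mod 2 ^ (n + r)])%N <-> (2 ^ (n + r) %| c)%N.
  by rewrite -eqn_mod_dvd// eq_sym; split => /eqP.
have cE k : v (l ^+ (2 ^ r * k) - 1) <= 2 ^- (q + n) <-> (2 ^ n %| k)%N.
  by rewrite exprM (absK_exp_sub1 _ _ l_exact q2).
split=> [lc|]; last first.
  move=> /dvdnP[k ->].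
  have -> : (k * 2 ^ (n + r) = 2 ^ r * (2 ^ n * k))%N by rewrite expnD; ring.
  by rewrite cE dvdn_mulr.
have : (c == 0 %[mod 2 ^ r])%N.
  apply: mod4_cancel; rewrite muln0 -gen4_congr expr0.
  apply: (@absK_sub_trans (l ^+ c)); first by rewrite absKB.
  exact: le_trans lc (le_q2 n).
rewrite mod0n => /dvdnP[k ck]; move: lc; rewrite ck mulnC cE => kn.
by rewrite addnC expnD dvdn_pmul2l ?expn_gt0.
Qed.

(** The quotient of [u] by [l ^+ n * x] lies in W_q, where the powers of [l ^+ (2 ^ r)] are
    dense. *)
Lemma rotation_cover u x n : norm1 u -> norm1 x ->
  v (u - l ^+ n * x) <= 2 ^- q ->
  forall t, exists j, v (u - l ^+ j * x) <= 2 ^- (q + t).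
Proof.
move=> nu nx ux t; pose y := l ^+ n * x.
have ny : norm1 y by apply: norm1M => //; exact: norm1X.
have y1 := absK_norm1 ny; have y0 := norm1_neq0 ny.
have nz : norm1 (u / y) by apply: norm1M => //; exact: norm1V.
have zE z : v (u - y * z) = v (u / y - z).
  by rewrite -(absK_sub_unitl (u / y) z y1) [_ * (_ / _)]mulrC divfK.
have [|j _ uj] := norm1_cover nz (norm1X (2 ^ r) nl) q2 l_exact _ t.
  by rewrite -zE mulr1.
by exists (n + 2 ^ r * j)%N; rewrite exprD exprM mulrAC zE.
Qed.

(** The parameter 1/2 has absolute value 2, the least one above 1, so [w] topologically generates
    W_2. *)
Let w : K := cayley 2^-1.
Let nw : norm1 w. Proof. by right; exists 2^-1. Qed.
Let wq : v (w - 1) = 2 ^- 2.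
Proof.
apply: absK_cayley_sub1_big => //.
by rewrite iotaV iota_nat absKV absK2 invrK expr1.
Qed.

(** Coset representatives of the powers of [l] modulo W_q. The remainder of [k] chooses a coset in
    the cyclic group of order 4, and the quotient an element of W_2/W_q, of order [2 ^ (q - 2)]. *)
Definition rotation_rep k : K :=
  gen4 ^+ (k %% 2 ^ (2 - r)) * w ^+ (k %/ 2 ^ (2 - r)).

Lemma norm1_rotation_rep k : norm1 (rotation_rep k).
Proof. by apply: norm1M; apply: norm1X => //; exact: norm1_gen4. Qed.

Let card_rep : (2 ^ (q - r) = 2 ^ (q - 2) * 2 ^ (2 - r))%N.
Proof. by rewrite -expnD; congr (_ ^ _)%N; lia. Qed.

Lemma rotation_rep_cover u : norm1 u ->
  exists k n, (k < 2 ^ (q - r))%N /\ v (u - l ^+ n * rotation_rep k) <= 2 ^- q.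
Proof.
move=> nu; have [a ua] := norm1_mod4 nu.
set P := (2 ^ (2 - r))%N; have P0 : (0 < P)%N by rewrite expn_gt0.
(* An odd [o] is its own inverse modulo 4, so the factor [o] in [n] turns [l ^+ n] into
   [gen4 ^+ (P * (a %/ P))] modulo W_2. *)
pose i := (a %% P)%N; pose n := (o * (a %/ P))%N.
pose y := l ^+ n * gen4 ^+ i.
have ny : norm1 y by apply: norm1M; apply: norm1X => //; exact: norm1_gen4.
have y1 := absK_norm1 ny; have y0 := norm1_neq0 ny.
have uy : v (u - y) <= 2 ^- 2.
  apply: absK_sub_trans ua _; rewrite absKB.
  apply: (@absK_sub_trans (gen4 ^+ (P * o * n) * gen4 ^+ i)).
    by rewrite /y ![_ * gen4 ^+ i]mulrC absK_sub_unitl ?l_gen4// absKX g1 expr1n.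
  rewrite -exprD gen4_congr.
  have o2 : (o * o = 1 %[mod 4])%N.
    rewrite -modnMm; have : (o %% 4 %% 2 = 1)%N by rewrite modn_dvdm// modn2 oo.
    by have := ltn_pmod o (isT : 0 < 4)%N; case: (o %% 4)%N => [|[|[|[|]]]].
  rewrite /n mulnA -(mulnA P) (mulnC P) -mulnA mulnC -modnDml -modnMmr o2.
  by rewrite modnMmr muln1 modnDml mulnC -divn_eq.
have nz : norm1 (u / y) by apply: norm1M => //; exact: norm1V.
have zE z : v (u - y * z) = v (u / y - z).
  by rewrite -(absK_sub_unitl (u / y) z y1) [_ * (_ / _)]mulrC divfK.
have uy1 : v (u / y - 1) <= 2 ^- 2 by rewrite -zE mulr1.
have [j jq uj] := norm1_cover nz nw (isT : 2 <= 2)%N wq uy1 (q - 2).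
exists (j * P + i)%N, n; rewrite card_rep -/P; split.
  apply: (@leq_trans (j.+1 * P)); last by rewrite leq_mul2r jq orbT.
  by rewrite mulSn addnC ltn_add2r ltn_mod.
rewrite /rotation_rep -/P modnMDl modn_small ?ltn_mod// divnMDl// divn_small ?ltn_mod//.
by rewrite addn0 mulrA zE; rewrite subnKC in uj.
Qed.

(** Reduction modulo W_2 recovers the remainder of [k] and the class of [n] modulo [2 ^ r]. The
    powers of [l] then agree modulo W_q and cancel, leaving the powers of [w]. *)
Lemma rotation_rep_inj k k' n m : (k < 2 ^ (q - r))%N -> (k' < 2 ^ (q - r))%N ->
  v (l ^+ n * rotation_rep k - l ^+ m * rotation_rep k') <= 2 ^- q -> k = k'.
Proof.
rewrite /rotation_rep card_rep; set P := (2 ^ (2 - r))%N => kq kq'.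
have P0 : (0 < P)%N by rewrite expn_gt0.
set i := (k %% P)%N; set i' := (k' %% P)%N.
set j := (k %/ P)%N; set j' := (k' %/ P)%N => h.
have w1 : v w = 1 by exact: absK_norm1.
have red a b c : v (l ^+ a * (gen4 ^+ b * w ^+ c) - gen4 ^+ (P * o * a + b)) <= 2 ^- 2.
  have -> : gen4 ^+ (P * o * a + b) = gen4 ^+ (P * o * a) * (gen4 ^+ b * 1).
    by rewrite mulr1 exprD.
  have u1 x b' : v x = 1 -> v (x ^+ b') = 1 by move=> x1; rewrite absKX x1 expr1n.
  apply: absK_sub_mul (l_gen4 a) _; rewrite ?mulr1 ?u1//.
  rewrite -[X in _ - X]mulr1 absK_sub_unitl ?u1// -[X in _ - X](expr1n _ c).
  by rewrite absK_sub_exp ?absK1 ?wq.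
have exps : (P * o * n + i == P * o * m + i' %[mod 4])%N.
  rewrite -gen4_congr; apply: absK_sub_trans (red m i' j').
  apply: (@absK_sub_trans (l ^+ n * (gen4 ^+ i * w ^+ j))); first by rewrite absKB.
  by apply: le_trans h _; rewrite -[q]addn0.
have ii' : i = i'.
  have P4 : (P %| 4)%N by rewrite -pow4 dvdn_mulr.
  move/eqP: exps => /(congr1 (modn^~ P)); rewrite !modn_dvdm//.
  by rewrite -!(mulnA P) !(mulnC P) !modnMDl !modn_mod.
have nm : (n == m %[mod 2 ^ r])%N.
  by apply: mod4_cancel; move: exps; rewrite ii' eqn_modDr.
have lnm : v (l ^+ n - l ^+ m) <= 2 ^- q.
  by rewrite -[q]addn0; apply/rotation_period; rewrite add0n; exact/eqP.
have jj' : (j == j' %[mod 2 ^ (q - 2)])%N.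
  rewrite -(absK_exp_congr _ _ _ wq)// subnKC//.
  rewrite -(@absK_sub_unitl (l ^+ n * gen4 ^+ i)); last first.
    by rewrite absKM !absKX l1 g1 !expr1n mulr1.
  apply: (@absK_sub_trans (l ^+ m * (gen4 ^+ i' * w ^+ j'))).
    by rewrite -mulrA.
  rewrite -mulrA ii' ![_ * (_ * _)]mulrC absK_sub_unitl 1?absKB//.
  by rewrite absKM !absKX w1 g1 !expr1n mulr1.
have bound x : (x < 2 ^ (q - 2) * P)%N -> (x %/ P < 2 ^ (q - 2))%N.
  by move=> xq; rewrite ltn_divLR.
rewrite (divn_eq k P) (divn_eq k' P) -/i -/i' ii' -/j -/j'.
by move/eqP: jj'; rewrite !modn_small ?bound// => ->.
Qed.

End Rotation.

(** * The action on the projective line *)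

Section Homographic.
Variables a b c d p : Q2.
Hypotheses (c0 : c != 0) (p0 : p != 0).
Hypothesis DeltaE : iota ((d - a) ^+ 2 + 4 * b * c) = (iota p * s) ^+ 2.

Local Notation phi := (homographic a b c d).

Let two0 : 2 != 0 :> Q2.
Proof. by rewrite -iota_eq0 iota_nat -absK_eq0 absK2 invr_eq0. Qed.

(** The affine map whose extension to K sends the two fixed points, the roots of c z^2 + (d - a) z -
    b, to s and -s. *)
Let tau (z : Q2) : Q2 := (2 * c * z + d - a) / p.

(* The coordinate (z - z1) / (z - z2) on P1(Q2), where z1 and z2 are the two
   conjugate fixed points of phi in Q2(s). *)
Definition fixpoint_coord (x : P1Q2) : K :=
  if x is Some z then cayley (tau z) else 1.

Local Notation psi := fixpoint_coord.
Let l : K := cayley ((a + d) / p).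

Let iotaX x n : iota (x ^+ n) = iota x ^+ n.
Proof. exact: rmorphXn. Qed.

Let sqr_s : iota (((d - a) ^+ 2 + 4 * b * c) / p ^+ 2) = s ^+ 2.
Proof.
rewrite iotaM DeltaE iotaV iotaX exprMn mulrAC divff ?mul1r//.
by rewrite expf_neq0// iota_eq0.
Qed.

(** In the parameter, multiplication by [l] is the law of [cayleyM] with first argument (a + d)/p.
    The sum of the two arguments is 2(cz + d)/p, which vanishes exactly at the pole of phi. *)
Lemma fixpoint_coord_homographic x : psi (phi x) = l * psi x.
Proof.
case: x => [z|] /=; last first.
  rewrite (negbTE c0) mulr1; congr cayley; rewrite /tau.
  by field; rewrite p0 c0.
have [z0|z0] := eqVneq (c * z + d) 0.
  rewrite /= -(cayleyN_mul ((a + d) / p)); congr (_ * cayley _); rewrite /tau.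
  have -> : d = - (c * z) by apply/eqP; rewrite -addr_eq0 addrC z0.
  by field.
have zE : (a + d) / p + tau z = 2 * (c * z + d) / p by rewrite /tau; field.
rewrite /l (cayleyM sqr_s) zE ?mulf_neq0 ?invr_eq0//; congr cayley.
by rewrite /tau; field; rewrite p0 z0 two0.
Qed.

Lemma norm1_fixpoint_coord x : norm1 (psi x).
Proof. by case: x => [z|]; [right; exists (tau z)|exact: norm11]. Qed.

Lemma fixpoint_coord_surj u : norm1 u -> exists x, psi x = u.
Proof.
case=> [->|[t ->]]; first by exists None.
exists (Some ((p * t + a - d) / (2 * c))); rewrite /= /tau; congr cayley.
by field; rewrite ?p0 ?c0 ?two0.
Qed.

Let tauB z z' : tau z - tau z' = 2 * c / p * (z - z').
Proof. by rewrite /tau; field. Qed.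

Let C : R := v (iota (2 * c / p)).
Let C0 : 0 < C.
Proof. by rewrite absK_gt0 iota_eq0 !mulf_neq0 ?invr_eq0. Qed.

Lemma fixpoint_coord_inj x y : psi x = psi y -> x = y.
Proof.
have neq1 t : cayley t <> 1.
  move=> /eqP; rewrite -subr_eq0 -absK_eq0 absK_cayley_sub1 mulf_eq0 !invr_eq0.
  by rewrite absK_eq0 (negbTE (shift_neq0 _)) pnatr_eq0.
case: x y => [z|] [z'|] //=; first 1 last.
- by move=> /neq1.
- by move=> /esym /neq1.
move=> /eqP; rewrite -subr_eq0 -absK_eq0 absK_cayley_sub tauB iotaM absKM.
rewrite -/C !mulf_eq0 (gt_eqF C0) !invr_eq0 !mulf_eq0 !absK_eq0.
rewrite !(negbTE (shift_neq0 _)) pnatr_eq0 !orbF /= iota_eq0 subr_eq0.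
by move=> /eqP ->.
Qed.

(** At a finite point the denominators are bounded below, so the coordinate is Lipschitz. Near
    infinity its distance to 1 is 1/(2|tau z|). *)
Lemma nbhs_fixpoint_coord x e : 0 < e -> nbhs x [set y | v (psi x - psi y) <= e].
Proof.
move=> e0; case: x => [z|].
  have [N Ne] := exp2V_lt (divr_gt0 e0 C0).
  have B : nbhs z (ball z (2 ^- N)) by apply: nbhsx_ballx; rewrite invr_gt0 exprn_gt0.
  apply: filterS B => y; rewrite ballEmdist /= => zy.
  have {}zy : v (iota (z - y)) < 2 ^- N.
    rewrite absK_in_alg (_ : 2 ^- N = ratr (2 ^- N))//; first by rewrite ltr_rat.
    by rewrite fmorphV rmorphXn rmorph_nat.
  rewrite absK_cayley_sub tauB iotaM absKM -/C.
  have ge t : v (1 - s) <= v (iota t - s) := absK_shift_ge t.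
  have den : 2^-1 <= v (iota (tau z) - s) * v (iota (tau y) - s).
    by rewrite -absK_1sub_sqr expr2 ler_pM ?absK_ge0.
  rewrite ler_pdivrMr ?(lt_le_trans _ den) ?invr_gt0//.
  rewrite ltr_pdivlMr// in Ne.
  have h : C * v (iota (z - y)) <= e.
    by apply: ltW (lt_trans _ Ne); rewrite mulrC ltr_pM2r.
  rewrite mulrC; apply: ler_pM => //.
  by rewrite mulr_ge0 ?absK_ge0// ltW.
(* Here tau z = (2c/p)(z + h). The three bounds on [N] ensure, for |z| > 2^N, that |z| exceeds |h|,
   that |tau z| > 1, and that |tau z| > 1/e. *)
pose h := (d - a) / (2 * c).
have h0 : 0 < (v (iota h) + 1)^-1 by rewrite invr_gt0 ltr_wpDl ?absK_ge0.
have m0 : 0 < Num.min C (Num.min (C * e) (v (iota h) + 1)^-1).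
  by rewrite !lt_min C0 mulr_gt0.
have [N] := exp2V_lt m0; rewrite !lt_min => /and3P[N1 N2 N3].
have N0 : 0 < 2 ^+ N :> R by rewrite exprn_gt0.
exists [set z | abs2 z <= 2 ^+ N].
  split; first exact: Q2_ball_compact.
  apply: compact_closed; last exact: Q2_ball_compact.
  exact: metric_hausdorff.
move=> _ [[z /= /negP zN <-]|->]; last by rewrite /= subrr absK0 ltW.
rewrite -ltNge in zN; rewrite /= absKB absK_cayley_sub1.
have {}zN : 2 ^+ N < v (iota z).
  by rewrite absK_in_alg (_ : 2 ^+ N = ratr (2 ^+ N)) ?ltr_rat// rmorphXn rmorph_nat.
have hz : v (iota h) < v (iota z).
  apply: lt_trans zN; rewrite ltf_pV2 ?posrE ?ltr_wpDl ?absK_ge0// in N3.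
  by apply: lt_trans N3; rewrite ltrDl.
have tE : v (iota (tau z)) = C * v (iota z).
  have -> : tau z = 2 * c / p * (z + h).
    by rewrite /tau /h; field; rewrite ?p0 ?c0 ?two0.
  by rewrite iotaM absKM iotaD absKD_lt.
have CN : C * 2 ^+ N < v (iota (tau z)) by rewrite tE ltr_pM2l.
have t1 : 1 < v (iota (tau z)).
  by apply: lt_trans CN; rewrite -ltr_pdivrMr// mul1r.
have te : e^-1 < v (iota (tau z)).
  apply: lt_trans CN; rewrite -[X in X < _]mul1r ltr_pdivrMr// mulrAC.
  by rewrite -ltr_pdivrMr// mul1r.
have t0 : 0 < v (iota (tau z)) := lt_trans ltr01 t1.
rewrite absK_shift_gt1// ler_pdivrMr// (@le_trans _ _ 1)//; first by lra.
by rewrite mulrC -ler_pdivrMr// mul1r ltW.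
Qed.

(** * Orbit closures of the homographic map *)

Section Orbits.
Variables (r o q : nat).
Hypotheses (r2 : (r <= 2)%N) (oo : odd o) (q2 : (2 <= q)%N).
Hypothesis l_mod4 : v (l - gen4 ^+ (2 ^ (2 - r) * o)) <= 2 ^- 2.
Hypothesis l_exact : v (l ^+ (2 ^ r) - 1) = 2 ^- q.

(** Congruence modulo W_(q+n). The shift by [q] makes level 0 the depth at which the powers of
    [l ^+ (2 ^ r)] begin to fill whole classes, as [Ecov] demands. *)
Let E n (x y : P1Q2) : Prop := v (psi x - psi y) <= 2 ^- (q + n).

Let nl : norm1 l. Proof. by right; eexists. Qed.

Let psi_iter n x : psi (iter n phi x) = l ^+ n * psi x.
Proof.
elim: n => [|n IH]; first by rewrite expr0 mul1r.
by rewrite iterS fixpoint_coord_homographic IH exprS mulrA.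
Qed.

Let Erefl n x : E n x x.
Proof. by rewrite /E subrr absK0 invr_ge0 exprn_ge0. Qed.
Let Esym n x y : E n x y -> E n y x.
Proof. by rewrite /E absKB. Qed.
Let Etrans n x y z : E n x y -> E n y z -> E n x z.
Proof. exact: absK_sub_trans. Qed.
Let Ele n m x y : (n <= m)%N -> E m x y -> E n x y.
Proof.
move=> nm h; apply: le_trans h _.
by rewrite lef_pV2 ?posrE ?exprn_gt0// ler_eXn2l ?ltr1n// leq_add2l.
Qed.
Let E_nbhs n x : nbhs x (E n x).
Proof. by apply: nbhs_fixpoint_coord; rewrite invr_gt0 exprn_gt0. Qed.
Let Esep x y : (forall n, E n x y) -> x = y.
Proof.
move=> xy; apply: fixpoint_coord_inj; apply/eqP; rewrite -subr_eq0 -absK_eq0.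
rewrite eq_le absK_ge0 andbT leNgt; apply/negP => /exp2V_lt[N].
apply/negP; rewrite -leNgt; apply: le_trans (xy N) _.
by rewrite lef_pV2 ?posrE ?exprn_gt0// ler_eXn2l ?ltr1n// leq_addl.
Qed.
Let Ef n x y : E n x y -> E n (phi x) (phi y).
Proof. by rewrite /E !fixpoint_coord_homographic absK_sub_unitl// absK_cayley. Qed.
Let Eper n x i j :
  E n (iter i phi x) (iter j phi x) <-> i = j %[mod 2 ^ (n + r)].
Proof.
rewrite /E !psi_iter ![_ * psi x]mulrC absK_sub_unitl; last first.
  exact: absK_norm1 (norm1_fixpoint_coord x).
exact: (rotation_period nl r2 oo q2 l_mod4 l_exact).
Qed.
Let Ecov x y n : E 0 y (iter n phi x) -> forall t, exists j, E t y (iter j phi x).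
Proof.
rewrite /E psi_iter addn0 => yx t.
have [j yj] := rotation_cover nl q2 l_exact (norm1_fixpoint_coord y)
  (norm1_fixpoint_coord x) yx t.
by exists j; rewrite psi_iter.
Qed.

Let X_compact : compact [set: P1Q2].
Proof. exact: one_point_compactification_compact. Qed.

Lemma homographic_decomposed : decomposed_into phi (2 ^ (q - r)).
Proof.
have [x xE] := choice (fun k : 'I_(2 ^ (q - r)) =>
  fixpoint_coord_surj (norm1_rotation_rep r k)).
apply: (decomposed_into_hulls X_compact Erefl Esym Etrans Ele E_nbhs Esep Ef Eper
  Ecov (x := x)) => [y|k k' n m].
  have [k [n [kq yk]]] :=
    rotation_rep_cover nl r2 oo q2 l_mod4 (norm1_fixpoint_coord y).
  by exists (Ordinal kq), n; rewrite /E psi_iter xE addn0.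
rewrite /E !psi_iter !xE addn0 => h; apply/val_inj.
exact: (rotation_rep_inj nl r2 oo q2 l_mod4 l_exact (ltn_ord k) (ltn_ord k') h).
Qed.

Lemma homographic_minimal_conjugate (A : set P1Q2) : A !=set0 ->
  minimal_subsystem phi A ->
  topologically_conjugate A phi (odometer pow2) (adding_machine pow2).
Proof.
move=> [x Ax] Amin.
rewrite (minimal_subsystem_hull X_compact Esym Etrans Ele E_nbhs Esep Amin Ax).
exact: (hull_conjugate X_compact Esym Etrans Ele E_nbhs Esep Ef Eper Ecov).
Qed.

End Orbits.

(** * The number of orbit closures in the three cases *)

Hypothesis l_not_root : ~ is_root_of_unity l.

Let conjugate_orbits := forall A : set P1Q2, A !=set0 -> minimal_subsystem phi A ->
  topologically_conjugate A phi (odometer pow2) (adding_machine pow2).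

Lemma homographic_orbits r o : (r <= 2)%N -> odd o ->
  v (l - gen4 ^+ (2 ^ (2 - r) * o)) <= 2 ^- 2 ->
  exists q, [/\ (2 <= q)%N, v (l ^+ (2 ^ r) - 1) = 2 ^- q,
    decomposed_into phi (2 ^ (q - r)) & conjugate_orbits].
Proof.
move=> r2 oo lg.
have g1 : v gen4 = 1 := absK_norm1 norm1_gen4.
have near : v (l ^+ (2 ^ r) - 1) <= 2 ^- 2.
  apply: (@absK_sub_trans (gen4 ^+ (2 ^ (2 - r) * o * 2 ^ r))).
    rewrite [in X in _ - X]exprM absK_sub_exp ?absK_cayley//.
    by rewrite absKX g1 expr1n.
  rewrite -(expr0 gen4) gen4_congr mulnAC -expnD subnK//.
  by rewrite modnMr mod0n.
have nl : norm1 l by right; eexists.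
have l_neq1 : l ^+ (2 ^ r) != 1.
  by apply/eqP => l1; apply: l_not_root; exists (2 ^ r)%N; rewrite ?expn_gt0.
have [q q2 lq] := norm1_sub1_val (norm1X (2 ^ r) nl) l_neq1 near.
exists q; split=> //; first exact: homographic_decomposed r2 oo q2 lg lq.
by move=> A A0 Amin; exact: homographic_minimal_conjugate r2 oo q2 lg lq A A0 Amin.
Qed.

Let rho := v (iota ((a + d) / p)).

Let exp2V_half q : (0 < q)%N -> 2 ^- q = 2 ^- q.-1 / 2 :> R.
Proof. by case: q => // q _; rewrite exprS invfM mulrC. Qed.

Lemma homographic_orbits_gt1 : 1 < rho ->
  exists q, [/\ v (l - 1) = 2 ^- q, decomposed_into phi (2 ^ q) & conjugate_orbits].
Proof.
move=> rho1.
have [|q [_ lq dec conj]] := @homographic_orbits 0 1 isT isT.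
  rewrite subn0 muln1; apply: (@absK_sub_trans 1); last by rewrite absKB gen4_exp4.
  have [m m0 rm] := absK_in_alg_gt1 rho1; rewrite (absK_cayley_sub1_big rm m0).
  by rewrite lef_pV2 ?posrE ?exprn_gt0// ler_eXn2l ?ltr1n.
by exists q; split=> //; rewrite ?subn0// in dec.
Qed.

Lemma homographic_orbits_lt1 : rho < 1 ->
  exists q, [/\ v (l + 1) = 2 ^- q, decomposed_into phi (2 ^ q) & conjugate_orbits].
Proof.
move=> rho1; have l4 := absK_cayley_even rho1.
have [|q [q2 lq dec conj]] := @homographic_orbits 1 1 isT isT.
  rewrite muln1; apply: (@absK_sub_trans (- 1)); first by rewrite opprK.
  by rewrite -opprD absKN addrC gen4_sqr.
(* Near -1 one has |l - 1| = 1/2, so |l^2 - 1| = |l + 1|/2; this accounts for the shift from [q] to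
   [q.-1]. *)
exists q.-1; split=> //; last by rewrite -subn1.
have lm : v (l - 1) = 2^-1.
  have -> : l - 1 = - 2 + (l + 1) by ring.
  by rewrite absKD_lt absKN absK2 ?(le_lt_trans l4)//; lra.
apply: (@mulIf _ 2^-1); first by rewrite invr_eq0.
by rewrite -exp2V_half ?(leq_trans _ q2)// -lq -{1}lm mulrC -absKM -subr_sqr_1.
Qed.

Lemma homographic_orbits_eq1 : rho = 1 ->
  exists q, [/\ v (l ^+ 2 + 1) = 2 ^- q.+1, decomposed_into phi (2 ^ q) &
    conjugate_orbits].
Proof.
move=> rho1.
have nl : norm1 l by right; eexists.
have g1 : v gen4 = 1 := absK_norm1 norm1_gen4.
(* This value does double duty: it excludes an even exponent of [gen4], which would give at most
   1/4, and it converts |l^4 - 1| into |l^2 + 1|/2. *)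
have l_far : v (l ^+ 2 - 1) = 2^-1.
  have n1 := shift_neq0 ((a + d) / p).
  have -> : l ^+ 2 - 1 =
      2 * 2 * s * iota ((a + d) / p) / (iota ((a + d) / p) - s) ^+ 2.
    by rewrite /l /cayley; move: (iota _) n1 => x n1; field.
  rewrite absKf absKX absK_shift_eq1// absK_1sub_sqr !absKM absK2 absK_sqrt -/rho rho1.
  by rewrite !mulr1 mulfK.
have [k lk] := norm1_mod4 nl.
have ok : odd k.
  apply: contraT => ke; have : v (l ^+ 2 - 1) <= 2 ^- 2.
    apply: (@absK_sub_trans (gen4 ^+ (k * 2))).
      by rewrite exprM absK_sub_exp ?absK_cayley// absKX g1 expr1n.
    rewrite -(expr0 gen4) gen4_congr mod0n -[k](odd_double_half k) (negbTE ke) add0n.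
    by rewrite -muln2 -mulnA modnMl.
  by rewrite l_far; lra.
have [|q [q2 lq dec conj]] := @homographic_orbits 2 k isT ok.
  by rewrite mul1n.
exists (q - 2)%N; split=> //.
apply: (@mulIf _ 2^-1); first by rewrite invr_eq0.
have -> : (q - 2).+1 = q.-1 by lia.
rewrite -exp2V_half ?(leq_trans _ q2)// -lq -{1}l_far -absKM; congr v.
by ring.
Qed.

End Homographic.

(** * Values and ramification of Q2(s) *)

Lemma generated_by_lin x : generated_by s -> exists p q, x = iota p + iota q * s.
Proof.
move=> gs; have : x \in <<1; s>>%VS by rewrite gs memvf.
move=> /Fadjoin1_polyP[f ->]; elim/poly_ind: f => [|f c [p [q E]]].
  by exists 0, 0; rewrite rmorph0 horner0 iota0 mul0r addr0.
have [D DE] : exists D : Q2, iota D = s ^+ 2.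
  by case: sP => ->; [exists (-1); rewrite iotaN iota1|exists 3; rewrite iota_nat].
exists (q * D + c), p.
have -> : (map_poly iota (f * 'X + c%:P)).[s] = (map_poly iota f).[s] * s + iota c.
  by rewrite rmorphD rmorphM /= map_polyX map_polyC hornerD hornerMX hornerC.
by rewrite E iotaD iotaM DE; ring.
Qed.

(** After a factor from Q2 is removed, [x] is in Q2 or has the form t + s, and the three possible
    values of |t - s| apply. *)
Lemma absK_sqr_exp x : generated_by s -> x != 0 -> exists k : int, v x ^+ 2 = 2 ^ k.
Proof.
move=> gs; have [p [q ->]] := generated_by_lin x gs => x0.
have sqr y k : v y = 2 ^ k -> v y ^+ 2 = 2 ^ (k * 2) by move=> ->; rewrite -exprz_exp.
have [q0|q0] := eqVneq q 0.
  have p0 : p != 0.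
    by apply: contra x0 => /eqP ->; rewrite q0 iota0 mul0r addr0.
  rewrite q0 iota0 mul0r addr0; have [k pk] := absK_in_alg_exp p0.
  by exists (k * 2); exact: sqr.
have -> : iota p + iota q * s = iota q * (iota (p / q) + s).
  rewrite iotaM iotaV mulrDr; congr (_ + _).
  by rewrite mulrCA divff ?mulr1// iota_eq0.
have [k qk] := absK_in_alg_exp q0.
suff [m tm] : exists m : int, v (iota (p / q) - s) ^+ 2 = 2 ^ m.
  exists (k * 2 + m); rewrite absKM absK_shiftD exprMn tm (sqr _ _ qk).
  by rewrite -expfzDr.
have [t1|t1|t1] := ltgtP (v (iota (p / q))) 1.
- by exists 0; rewrite absK_shift_lt1// expr1n.
- have [m _ tm] := absK_in_alg_gt1 t1.
  by exists (m%:Z * 2); apply: sqr; rewrite absK_shift_gt1.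
- by exists (-1); rewrite absK_shift_eq1// absK_1sub_sqr.
Qed.

(** [1 - s] is a uniformizer: |pi|^2 is an integer power of 2 below 1, hence at most 1/2 = |1 -
    s|^2, while |pi| is at least |1 - s| by maximality. *)
Lemma ramification_index_2 pi e : generated_by s -> uniformizer v pi ->
  ramification_index v pi e -> e = 2%N.
Proof.
move=> gs [pi1 pimax]; rewrite /ramification_index absK2.
have pi_ge := pimax _ absK_1sub_lt1.
have pi0 : 0 < v pi := lt_le_trans absK_1sub_gt0 pi_ge.
have -> : v pi = v (1 - s).
  apply/eqP; rewrite eq_le pi_ge andbT -ler_sqr ?nnegrE ?absK_ge0//.
  have pi_neq0 : pi != 0 by rewrite -absK_gt0.
  rewrite absK_1sub_sqr; have [k pik] := absK_sqr_exp gs pi_neq0.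
  have : v pi ^+ 2 < 1 by rewrite expr_lt1 ?ltW.
  rewrite pik -[X in _ < X](expr0z 2) ltr_eXz2l ?ltr1n// => k0.
  by rewrite -[_^-1]/(2 ^ (-1)) ler_eXz2l ?ltr1n//; lia.
rewrite -absK_1sub_sqr => /(ieexprIn absK_1sub_gt0 _) <- //.
by rewrite lt_eqF ?absK_1sub_lt1.
Qed.

End NormOneGroup.

Lemma val_pi_exp2V x n : v x = 2 ^- n -> val_pi v 2 x = (2 * n)%:R.
Proof.
move=> xn; rewrite /val_pi xn lnV ?posrE ?exprn_gt0// lnXn// mulNr opprK.
rewrite -(mulr_natr (ln 2)) [_ / _]mulrAC divff ?mul1r ?natrM//.
by rewrite gt_eqF// ln_gt0// ltr1n.
Qed.

End AbsoluteValue.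

(** * From sqrt Delta to the generator s *)

Theorem theorem5p9 (R : realType) (a b c d : Q2)
    (K : fieldExtType Q2) (sqrtD : K) (absK : K -> R) (pi : K) (e : nat) :
  let phi := homographic a b c d in
  let Delta := (d - a) ^+ 2 + 4 * b * c in
  let lambda := ((a + d)%:A + sqrtD) / ((a + d)%:A - sqrtD) in
  let v_pi := val_pi absK e in
  a * d - b * c != 0 ->
  sqrtD ^+ 2 = Delta%:A ->
  ~ (exists r : Q2, r ^+ 2 = Delta) ->
  generated_by sqrtD ->
  extends_abs2 absK ->
  uniformizer absK pi ->
  ramification_index absK pi e ->
  ~ is_root_of_unity lambda ->
  (exists2 i : K, i ^+ 2 = -1 & generated_by i) \/
  (exists2 s : K, s ^+ 2 = 3 & generated_by s) ->
  [/\ absK (a + d)%:A = absK sqrtD ->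
        exists2 M : nat, M%:R = 2 `^ ((v_pi (lambda ^+ 2 + 1) - 2) / 2)
                       & decomposed_into phi M,
      absK (a + d)%:A > absK sqrtD ->
        exists2 M : nat, M%:R = 2 `^ (v_pi (lambda - 1) / 2)
                       & decomposed_into phi M,
      absK (a + d)%:A < absK sqrtD ->
        exists2 M : nat, M%:R = 2 `^ (v_pi (lambda + 1) / 2)
                       & decomposed_into phi M &
      forall E : set P1Q2, E !=set0 -> minimal_subsystem phi E ->
        topologically_conjugate E phi (odometer pow2) (adding_machine pow2)].
Proof.
move=> phi Delta lambda v_pi _ sqrE nonsq _ vP unif ram not_root Kgen.
have [s sP gs] : exists2 s : K, s ^+ 2 = -1 \/ s ^+ 2 = 3 & generated_by s.
  by case: Kgen => -[s sE gs]; exists s; [left| |right|].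
pose iota := in_alg K.
have iotaD x y : iota (x + y) = iota x + iota y by exact: rmorphD.
have iotaB x y : iota (x - y) = iota x - iota y by exact: rmorphB.
have iotaM x y : iota (x * y) = iota x * iota y by exact: rmorphM.
have iotaV x : iota x^-1 = (iota x)^-1 by exact: fmorphV.
have iotaX x n : iota (x ^+ n) = iota x ^+ n by exact: rmorphXn.
have iota_inj : injective iota by exact: fmorph_inj.
have iota_eq0 x : (iota x == 0) = (x == 0) by exact: fmorph_eq0.
have {}sqrE : sqrtD ^+ 2 = iota Delta by [].
have [x [p sqrtE]] := generated_by_lin sP sqrtD gs.
rewrite -/iota in sqrtE.
have p0 : p != 0.
  apply/eqP => p0; apply: nonsq; exists x; apply: iota_inj.
  by rewrite -sqrE sqrtE p0 iotaX [iota 0]rmorph0 mul0r addr0.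
(* Otherwise Delta = x^2 + 2xps + p^2 s^2 could be solved for [s] in Q2, contradicting
   [shift_neq0]. *)
have x0 : x = 0.
  apply/eqP/negPn/negP => x0.
  have [D DE] : exists D, iota D = s ^+ 2.
    case: sP => ->; first by exists (-1); rewrite [iota _]rmorphN1.
    by exists 3; exact: rmorph_nat.
  have two0 : iota 2 != 0.
    by rewrite [iota _]rmorph_nat -(absK_eq0 vP) (absK2 vP) invr_eq0.
  have := shift_neq0 vP sP ((Delta - x ^+ 2 - p ^+ 2 * D) / (2 * x * p)).
  rewrite -/(iota _) subr_eq0 => /eqP; apply.
  have n0 : 2 * x * p != 0 by rewrite !mulf_neq0// -iota_eq0.
  apply: (@mulIf _ (iota (2 * x * p))); first by rewrite iota_eq0.
  rewrite -[LHS]iotaM divfK// !iotaB !iotaM DE -sqrE sqrtE.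
  by rewrite [iota 2]rmorph_nat; ring.
have {}sqrtE : sqrtD = iota p * s by rewrite sqrtE x0 [iota 0]rmorph0 add0r.
have ip0 : iota p != 0 by rewrite iota_eq0.
have c0 : c != 0.
  apply/eqP => c0; apply: nonsq; exists (d - a).
  by rewrite /Delta c0 mulr0 addr0.
have DeltaE : iota Delta = (iota p * s) ^+ 2 by rewrite -sqrtE.
have lE : lambda = cayley s ((a + d) / p).
  rewrite /lambda /cayley -[(a + d)%:A]/(iota (a + d)) -!/(iota _) sqrtE iotaM iotaV.
  have := shift_neq0 vP sP ((a + d) / p); rewrite -/(iota _) iotaM iotaV.
  have : iota (a + d) = iota p * (iota (a + d) / iota p) by rewrite mulrC divfK.
  move: (iota (a + d) / iota p) => z -> n0.
  by rewrite -mulrDr -mulrBr -mulf_div divff// mul1r.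
have e2 := ramification_index_2 vP sP gs unif ram.
have vp0 : 0 < absK (iota p) by rewrite absK_gt0.
have vsq : absK sqrtD = absK (iota p) by rewrite sqrtE absKM// (absK_sqrt vP sP) mulr1.
have vad : absK (a + d)%:A = absK (iota ((a + d) / p)) * absK (iota p).
  by rewrite -absKM// -iotaM divfK.
have val_half n y : absK y = 2 ^- n -> v_pi y = (2 * n)%:R.
  by move=> yn; rewrite /v_pi e2; exact: val_pi_exp2V.
have pow n z : z = n%:R -> (2 ^ n)%:R = 2 `^ z :> R.
  by move=> ->; rewrite powR_mulrn// natrX.
rewrite {}lE in not_root *; rewrite vsq vad.
have gt1 := homographic_orbits_gt1 vP sP c0 p0 DeltaE not_root.
have lt1 := homographic_orbits_lt1 vP sP c0 p0 DeltaE not_root.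
have eq1 := homographic_orbits_eq1 vP sP c0 p0 DeltaE not_root.
split.
(* The valuation is 2(q + 1), so subtracting 2 and halving gives [q]. *)
- rewrite -{2}[absK (iota p)]mul1r => /(mulIf (lt0r_neq0 vp0)) /eq1[q [lq dec _]].
  exists (2 ^ q)%N => //; apply: pow; rewrite (val_half _ _ lq) mulnS natrD natrM.
  by rewrite addrC addKr mulrC mulKf.
- rewrite ltr_pMl// => /gt1[q [lq dec _]].
  by exists (2 ^ q)%N => //; apply: pow; rewrite (val_half _ _ lq) natrM mulrC mulKf.
- rewrite gtr_pMl// => /lt1[q [lq dec _]].
  by exists (2 ^ q)%N => //; apply: pow; rewrite (val_half _ _ lq) natrM mulrC mulKf.
- have [/lt1[q []]//|/gt1[q []]//|/eq1[q []]//] :=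
    ltgtP (absK (iota ((a + d) / p))) 1.
Qed.
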